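(* Let $\mathbf A$ be a non-trivial finite Ockham algebra. Then the following are equivalent: (1) $\mathbf A$ admits only finitely many relations; (2) there is an odd number $m\ge 1$ such that the dual space $H(\mathbf A)$ of $\mathbf A$ is isomorphic to $\mathbb C_m$, $\mathbb D_m$ or $\mathbb D_m^\partial$; (3) none of the eight Ockham spaces $\mathbb Y_1,\mathbb Y_2,\mathbb Y_3,\mathbb Y_4,\mathbb Y_4^\partial,\mathbb Y_5,\mathbb Y_6,\mathbb Y_6^\partial$ is a divisor of the dual space $H(\mathbf A)$ of $\mathbf A$.
   Context: An Ockham algebra $\mathbf A=\langle A;\vee,\wedge,f,0,1\rangle$ is a bounded distributive lattice $\mathbf A^\flat=\langle A;\vee,\wedge,0,1\rangle$ with a unary operation $f$ satisfying $f(0)=1$, $f(1)=0$, $f(x\vee y)=f(x)\wedge f(y)$, $f(x\wedge y)=f(x)\vee f(y)$. Non-trivial means having more than one element. Compatible relations. For a finite algebra $\mathbf A$ and $k\ge1$, a relation $r\subseteq A^k$ is compatible with $\mathbf A$ if it is a non-empty subuniverse of $\mathbf A^k$. For relations $r\subseteq A^k$ and $s\subseteq A^\ell$ ($k,\ell\ge1$), $r$ is conjunct-atomic definable from $s$ if $r=\{(a_1,\dots,a_k)\in A^k \mid \Phi_1(a_1,\dots,a_k)\ \&\ \cdots\ \&\ \Phi_n(a_1,\dots,a_k)\}$ for some $n\ge0$, where each $\Phi_i(x_1,\dots,x_k)$ is an atomic formula in $s$, i.e. of the form $x_i=x_j$ or $(x_{i_1},\dots,x_{i_\ell})\in s$.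 Two relations are equivalent if each is conjunct-atomic definable from the other. The algebra $\mathbf A$ admits only finitely many relations if the set of all compatible relations on $\mathbf A$ (of all arities $k\ge 1$) has finitely many equivalence classes under this equivalence. Dual space. A finite Ockham space is a finite ordered set $\langle X;\le\rangle$ (with the discrete topology) equipped with an order-reversing map $g\colon X\to X$. Morphisms are order-preserving maps that preserve $g$; isomorphisms are bijective morphisms whose inverses are morphisms. The dual space $H(\mathbf A)$ of a finite Ockham algebra $\mathbf A$ is the set of all bounded-lattice homomorphisms $x\colon\mathbf A^\flat\to\mathbf 2$ into the two-element bounded lattice on $\{0,1\}$, ordered pointwise, with $g(x)=(x\circ f)'$, where $'$ is Boolean complement on $\{0,1\}$. For Ockham spaces, $\mathbb X$ is a divisor of $\mathbb Y$ if $\mathbb X$ is the image of a substructure of $\mathbb Y$ (a subset closed under $g$, with the induced order) under a surjective morphism onto $\mathbb X$. The spaces, for odd $m\ge1$: $\mathbb C_m$: underlying set $\{0,1,\dots,m-1\}$, ordered as an antichain, $g(i)=i+1 \pmod m$. $\mathbb D_m$: underlying set $\{0,1,\dots,m\}$, the only strict order relation is $0<m$; $g(i)=i+1$ for $0\le i\le m-1$ and $g(m)=1$. $\mathbb D_m^\partial$: same set and same $g$ as $\mathbb D_m$, the only strict order relation is $m<0$. The eight spaces: $\mathbb Y_1$: antichain $\{0,1\}$, $g(0)=0$, $g(1)=1$. $\mathbb Y_2$: antichain $\{0,1\}$, $g(0)=g(1)=1$. $\mathbb Y_3$: chain $0<1$, $g(0)=1$, $g(1)=0$. $\mathbb Y_4$: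 chain $0<1<2$, $g(0)=g(1)=g(2)=2$. $\mathbb Y_5$: chain $0<1<2$, $g(0)=g(1)=g(2)=1$. $\mathbb Y_6$: chain $0<1<2$, $g(0)=1$, $g(1)=1$, $g(2)=0$. $\mathbb Y_4^\partial$ and $\mathbb Y_6^\partial$: obtained from $\mathbb Y_4$ and $\mathbb Y_6$ by reversing the order and keeping the same $g$. *)

(* Defs.v *)
From HB Require Import structures.
From mathcomp Require Import all_boot all_order.
From mathcomp Require Import boolp classical_sets functions cardinality.

Set Implicit Arguments.
Unset Strict Implicit.
Unset Printing Implicit Defensive.

Import Order.TTheory.
Local Open Scope order_scope.

HB.mixin Record hasOckhamNeg (d : Order.disp_t) T
    of Order.FinTBDistrLattice d T := {
  oneg : T -> T;
  onegF : oneg \bot = \top;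
  onegT : oneg \top = \bot;
  onegU : forall x y, oneg (x `|` y) = oneg x `&` oneg y;
  onegI : forall x y, oneg (x `&` y) = oneg x `|` oneg y
}.

#[short(type="finOckhamType")]
HB.structure Definition FinOckham (d : Order.disp_t) :=
  { T of hasOckhamNeg d T & Order.FinTBDistrLattice d T }.

Section Relations.
Variables (d : Order.disp_t) (A : finOckhamType d).

(* The signature includes the nullary operations 0 and 1, so a subuniverse of
   A^k contains both constant tuples. *)
Definition subuniverse k (r : {set k.-tuple A}) : Prop :=
  [/\ [tuple \bot | _ < k] \in r,
      [tuple \top | _ < k] \in r,
      forall a b, a \in r -> b \in r ->
        [tuple tnth a i `|` tnth b i | i < k] \in r,
      forall a b, a \in r -> b \in r ->
        [tuple tnth a i `&` tnth b i | i < k] \in r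
    & forall a, a \in r -> [tuple oneg (tnth a i) | i < k] \in r].

Definition compatible k (r : {set k.-tuple A}) : Prop :=
  (exists a, a \in r) /\ subuniverse r.

(* Atomic formulas in the variables x_0, ..., x_(k-1) and one l-ary relation
   symbol. *)
Inductive atomic (k l : nat) :=
  | AtomEq of 'I_k & 'I_k
  | AtomRel of l.-tuple 'I_k.

Definition sat k l (s : {set l.-tuple A}) (a : k.-tuple A)
    (phi : atomic k l) : bool :=
  match phi with
  | AtomEq i j => tnth a i == tnth a j
  | AtomRel v => [tuple tnth a (tnth v j) | j < l] \in s
  end.

Definition conjunct_atomic_definable k l
    (r : {set k.-tuple A}) (s : {set l.-tuple A}) : Prop :=
  exists phis : seq (atomic k l), forall a, (a \in r) = all (sat s a) phis.

Record relation_on := RelationOn {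
  arity : nat;
  arity_gt0 : (0 < arity)%N;
  tuples : {set arity.-tuple A}
}.

Definition rel_equivalent (r s : relation_on) : Prop :=
  conjunct_atomic_definable (tuples r) (tuples s) /\
  conjunct_atomic_definable (tuples s) (tuples r).

Definition compatible_relations : set relation_on :=
  [set r | compatible (tuples r)]%classic.

Definition equivalence_class (r : relation_on) : set relation_on :=
  [set s | compatible_relations s /\ rel_equivalent r s]%classic.

Definition admits_finitely_many_relations : Prop :=
  finite_set [set equivalence_class r | r in compatible_relations]%classic.

End Relations.

Record ockham_space := OckhamSpace {
  os_disp : Order.disp_t;
  os_sort :> finPOrderType os_disp;
  os_g : os_sort -> os_sort;
  os_gP : forall x y, x <= y -> os_g y <= os_g x
}.
Arguments os_g {o} _.

Definition os_morphism (X Y : ockham_space) (h : X -> Y) : Prop :=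
  (forall x y, x <= y -> h x <= h y) /\ (forall x, h (os_g x) = os_g (h x)).

Definition os_isomorphic (X Y : ockham_space) : Prop :=
  exists (h : X -> Y) (k : Y -> X),
    [/\ os_morphism h, os_morphism k, cancel h k & cancel k h].

Definition os_closed (Y : ockham_space) (S : {set Y}) : Prop :=
  forall y, y \in S -> os_g y \in S.

Section Substructure.
Variables (Y : ockham_space) (S : {set Y}).

Definition sub_carrier : Type := {y : Y | y \in S}.
HB.instance Definition _ := Finite.on sub_carrier.

Definition sub_le (x y : sub_carrier) : bool := sval x <= sval y.

Fact sub_le_refl : reflexive sub_le.
Proof. by move=> x; rewrite /sub_le. Qed.
Fact sub_le_anti : antisymmetric sub_le.
Proof. by move=> x y /le_anti /val_inj. Qed.
Fact sub_le_trans : transitive sub_le.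
Proof. by move=> y x z; apply: le_trans. Qed.

HB.instance Definition _ := Order.Le_isPOrder.Build (os_disp Y) sub_carrier
  sub_le_refl sub_le_anti sub_le_trans.

Hypothesis S_closed : os_closed S.

Definition sub_g (x : sub_carrier) : sub_carrier :=
  exist _ (os_g (sval x)) (S_closed (svalP x)).

Fact sub_gP (x y : sub_carrier) : x <= y -> sub_g y <= sub_g x.
Proof. by move=> xy; apply: (os_gP xy). Qed.

Definition os_sub : ockham_space := OckhamSpace sub_gP.
End Substructure.

Definition os_divisor (X Y : ockham_space) : Prop :=
  exists (S : {set Y}) (S_closed : os_closed S) (h : os_sub S_closed -> X),
    os_morphism h /\ (forall x, exists y, h y = x).

Section DualOrder.
Variable X : ockham_space.

Definition op_g (x : X^d) : X^d := os_g (x : X).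

Fact op_gP (x y : X^d) : x <= y -> op_g y <= op_g x.
Proof. exact: os_gP. Qed.

Definition os_op : ockham_space := OckhamSpace op_gP.
End DualOrder.

Section DualSpace.
Variables (d : Order.disp_t) (A : finOckhamType d).

(* The two-element lattice is bool, with false < true. *)
Definition is_bounded_lattice_hom (x : {ffun A -> bool}) : bool :=
  [&& x \bot == false, x \top == true,
      [forall a, forall b, x (a `|` b) == x a || x b]
    & [forall a, forall b, x (a `&` b) == x a && x b]].

Definition dual_carrier : Type :=
  {x : {ffun A -> bool} | is_bounded_lattice_hom x}.
HB.instance Definition _ := Finite.on dual_carrier.

Definition dual_le (x y : dual_carrier) : bool :=
  [forall a, sval x a <= sval y a].

Fact dual_le_refl : reflexive dual_le.
Proof. by move=> x; apply/forallP. Qed.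
Fact dual_le_anti : antisymmetric dual_le.
Proof.
move=> x y /andP[/forallP xy /forallP yx].
by apply/val_inj/ffunP => a; apply: le_anti; rewrite xy yx.
Qed.
Fact dual_le_trans : transitive dual_le.
Proof.
move=> y x z /forallP xy /forallP yz; apply/forallP => a.
exact: le_trans (xy a) (yz a).
Qed.

HB.instance Definition _ := Order.Le_isPOrder.Build d dual_carrier
  dual_le_refl dual_le_anti dual_le_trans.

Fact dual_g_hom (x : dual_carrier) :
  is_bounded_lattice_hom [ffun a => ~~ sval x (oneg a)].
Proof.
case: x => x /= /and4P[/eqP x0 /eqP x1 /'forall_forallP xU /'forall_forallP xI].
apply/and4P; split; rewrite ?ffunE ?onegF ?onegT ?x0 ?x1 //.
- by apply/'forall_forallP => a b; rewrite !ffunE onegU (eqP (xI _ _)) negb_and.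
- by apply/'forall_forallP => a b; rewrite !ffunE onegI (eqP (xU _ _)) negb_or.
Qed.

Definition dual_g (x : dual_carrier) : dual_carrier :=
  exist _ [ffun a => ~~ sval x (oneg a)] (dual_g_hom x).

Fact dual_gP (x y : dual_carrier) : x <= y -> dual_g y <= dual_g x.
Proof.
move=> /forallP xy; apply/forallP => a; rewrite !ffunE.
by move: (xy (oneg a)); case: (sval x _); case: (sval y _).
Qed.

Definition dual_space : ockham_space := OckhamSpace dual_gP.
End DualSpace.

(* 'I_n ordered as an antichain, instead of by its canonical linear order. *)
Definition antichain (n : nat) : Type := 'I_n.
HB.instance Definition _ n := Finite.on (antichain n).

Section Antichain.
Variable n : nat.

Fact antichain_anti : antisymmetric (@eq_op (antichain n)).
Proof. by move=> x y /andP[/eqP]. Qed.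
Fact antichain_trans : transitive (@eq_op (antichain n)).
Proof. by move=> y x z /eqP-> /eqP->. Qed.

HB.instance Definition _ := Order.Le_isPOrder.Build (Order.Disp tt tt)
  (antichain n) (@eqxx (antichain n)) antichain_anti antichain_trans.

Fact antichain_gP (g : antichain n -> antichain n) (x y : antichain n) :
  x <= y -> g y <= g x.
Proof. by move=> /eqP->. Qed.

Definition antichain_space (g : antichain n -> antichain n) : ockham_space :=
  OckhamSpace (antichain_gP g).
End Antichain.

(* ordS i is i.+1 %% m. *)
Definition space_C (m : nat) : ockham_space := antichain_space (@ordS m).

Definition D_carrier (m : nat) : Type := 'I_m.+1.
HB.instance Definition _ m := Finite.on (D_carrier m).

Section SpaceD.
Variable m : nat.

Definition D_le (x y : D_carrier m) : bool :=
  (x == y) || ((x == ord0) && (y == ord_max)).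

Fact D_le_refl : reflexive D_le.
Proof. by move=> x; rewrite /D_le eqxx. Qed.
Fact D_le_anti : antisymmetric D_le.
Proof.
move=> x y /andP[/orP[/eqP//|/andP[/eqP-> /eqP->]]].
by case/orP => [/eqP//|/andP[/eqP-> _]].
Qed.
Fact D_le_trans : transitive D_le.
Proof.
move=> y x z /orP[/eqP->//|/andP[/eqP-> /eqP->]] /orP[/eqP<-|/andP[_ /eqP->]];
by rewrite /D_le !eqxx orbT.
Qed.

HB.instance Definition _ := Order.Le_isPOrder.Build (Order.Disp tt tt)
  (D_carrier m) D_le_refl D_le_anti D_le_trans.

Definition D_g (x : D_carrier m) : D_carrier m :=
  if (nat_of_ord x < m)%N then inord (nat_of_ord x).+1 else inord 1.

Fact D_gP (x y : D_carrier m) : x <= y -> D_g y <= D_g x.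
Proof.
move=> /orP[/eqP->//|/andP[/eqP-> /eqP->]].
by rewrite /D_g /= ltnn; case: ifP.
Qed.

Definition space_D : ockham_space := OckhamSpace D_gP.
End SpaceD.

Local Notation elt n i := (@Ordinal n i isT).

(* A map g on 'I_n is given by the tuple of its values g(0), ..., g(n-1). *)
Definition Y1 : ockham_space :=
  antichain_space (n := 2) (tnth [tuple elt 2 0; elt 2 1]).

Definition Y2 : ockham_space :=
  antichain_space (n := 2) (tnth [tuple elt 2 1; elt 2 1]).

(* The canonical order of 'I_n is the chain 0 < 1 < ... < n-1. *)
Definition Y3_g : 'I_2 -> 'I_2 :=
  tnth [tuple elt 2 1; elt 2 0].
Fact Y3_gP (x y : 'I_2) : x <= y -> Y3_g y <= Y3_g x.
Proof. by case: x y => [[|[|?]] ?] [[|[|?]] ?]. Qed.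
Definition Y3 : ockham_space := OckhamSpace Y3_gP.

Definition Y4_g : 'I_3 -> 'I_3 :=
  tnth [tuple elt 3 2; elt 3 2; elt 3 2].
Fact Y4_gP (x y : 'I_3) : x <= y -> Y4_g y <= Y4_g x.
Proof. by case: x y => [[|[|[|?]]] ?] [[|[|[|?]]] ?]. Qed.
Definition Y4 : ockham_space := OckhamSpace Y4_gP.

Definition Y5_g : 'I_3 -> 'I_3 :=
  tnth [tuple elt 3 1; elt 3 1; elt 3 1].
Fact Y5_gP (x y : 'I_3) : x <= y -> Y5_g y <= Y5_g x.
Proof. by case: x y => [[|[|[|?]]] ?] [[|[|[|?]]] ?]. Qed.
Definition Y5 : ockham_space := OckhamSpace Y5_gP.

Definition Y6_g : 'I_3 -> 'I_3 :=
  tnth [tuple elt 3 1; elt 3 1; elt 3 0].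
Fact Y6_gP (x y : 'I_3) : x <= y -> Y6_g y <= Y6_g x.
Proof. by case: x y => [[|[|[|?]]] ?] [[|[|[|?]]] ?]. Qed.
Definition Y6 : ockham_space := OckhamSpace Y6_gP.

(* Main.v *)
Require Import Defs.
From mathcomp Require Import all_boot all_order.
From mathcomp Require Import zify.
From mathcomp Require Import boolp classical_sets cardinality.

(** The dual space X = H(A) turns algebra into finite combinatorics: the
    elements of A are the order-preserving maps X -> 2, and a compatible
    k-ary relation is the set of maps on k copies of X that respect a
    certain preorder there which g reverses. The three conditions are proved
    equivalent cyclically.

    A divisor among the eight spaces gives infinitely many relations. If Y
    is the image under h of a substructure of X, every order-preserving map
    Y -> 2 is lifted to an element of A ([monotone_realized]), and every
    g-closed set of inequalities between points of copies of Y defines a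
    compatible relation on A ([constrained_compatible]). For each of the
    eight spaces this gives a unary relation alpha and binary relations rho
    such that the relations r_n describing a path a_0, ..., a_n, anchored by
    alpha at a_0, are pairwise inequivalent: an atomic formula in r_m that
    is valid on r_n is a walk that starts at the anchor and moves at most
    one step at a time, hence for m < n it never mentions a_n, although r_n
    does restrict a_n ([infinitely_many_of_walks]). Apart from Y1, the path
    is a fence for one preorder rho ([infinitely_many_of_fence]).

    Without these divisors the dual space is small. Let K be the set of
    periodic points of X. An even cycle maps onto Y3, and once all cycles
    are odd K is an antichain, so that two cycles give Y1; hence K is a
    single odd cycle. A point x outside K whose image lies in K is
    comparable with the point of K having the same image, for otherwise Y2
    is a divisor, and with no other point of K. Two such points give Y4, its
    dual or Y5, and a longer tail gives Y6 or its dual ([classification]).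

    A small dual space allows finitely many relations. Let tau = g^m. On the
    space C_m it is the identity; on D_m and its dual it only moves the
    point 0. The preorder of a compatible relation is symmetric up to tau
    because m is odd, so it amounts to an equivalence telling which cyclic
    coordinates coincide, together with, for each position of the cycle, an
    order with a largest element among the variables there. The map sending
    all variables at one position to a single one respects such a structure,
    and so do maps onto two variables that are in order, or that no chain of
    comparable variables connects. This flexibility shows that a relation is
    determined up to equivalence by the set of pictures which its variables
    have of the others ([view]), and only finitely many such sets exist
    ([definable_of_same_views]). *)

Set Implicit Arguments.
Unset Strict Implicit.
Unset Printing Implicit Defensive.

Import Order.TTheory.

(** * Definability and the number of classes *)

Section Definability.
Variables (d : Order.disp_t) (A : finOckhamType d).

Definition valid k l (r : {set k.-tuple A}) (s : {set l.-tuple A})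
    (phi : atomic k l) : bool :=
  [forall b in r, sat s b phi].

(** There are only finitely many atomic formulas in given variables, so if any
    conjunction defines r, the conjunction of all formulas valid on r does.
    Definability thus becomes a statement about valid atoms only. *)
Lemma definableP k l (r : {set k.-tuple A}) (s : {set l.-tuple A}) :
  conjunct_atomic_definable r s <->
  (forall a, (forall phi, valid r s phi -> sat s a phi) -> a \in r).
Proof.
split=> [[phis rE] a aP | rP].
  have: forall b, b \in r -> all (sat s b) phis by move=> b; rewrite rE.
  rewrite rE {rE}; elim: phis => //= phi phis IH bP; apply/andP; split.
    by apply/aP/forall_inP => b /bP /andP[].
  by apply: IH => b /bP /andP[].
exists ([seq phi <- [seq AtomEq l p.1 p.2 | p : 'I_k * 'I_k] | valid r s phi] ++
        [seq phi <- [seq AtomRel v | v : l.-tuple 'I_k] | valid r s phi]) => a.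
rewrite all_cat !all_filter !all_map; apply/idP/idP => [ra | /andP[/allP eqs /allP rels]].
  by apply/andP; split; apply/allP => x _ /=; apply/implyP => /forall_inP; apply.
apply: rP => -[i j|v] vP.
  by apply: (implyP (eqs (i, j) _)); rewrite ?mem_enum.
by apply: (implyP (rels v _)); rewrite ?mem_enum.
Qed.

Lemma definable_refl k (r : {set k.-tuple A}) : conjunct_atomic_definable r r.
Proof.
apply/definableP => a /(_ (AtomRel (ord_tuple k))) /=.
have tupleE (b : k.-tuple A) : [tuple tnth b (tnth (ord_tuple k) j) | j < k] = b.
  by apply: eq_from_tnth => j; rewrite tnth_mktuple tnth_ord_tuple.
by rewrite tupleE; apply; apply/forall_inP => b; rewrite /= tupleE.
Qed.

Lemma definable_trans k l n (r : {set k.-tuple A}) (s : {set l.-tuple A})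
    (t : {set n.-tuple A}) :
  conjunct_atomic_definable r s -> conjunct_atomic_definable s t ->
  conjunct_atomic_definable r t.
Proof.
move=> /definableP rs /definableP st; apply/definableP => a aP.
apply: rs => -[i j|v] vP.
  by apply: (aP (AtomEq n i j)); apply/forall_inP => b /(forall_inP vP).
apply: st => -[i j|u] uP /=.
  rewrite !tnth_mktuple; apply: (aP (AtomEq n (tnth v i) (tnth v j))).
  apply/forall_inP => b /(forall_inP vP) /(forall_inP uP) /=.
  by rewrite !tnth_mktuple.
have tupleE (b : k.-tuple A) :
    [tuple tnth [tuple tnth b (tnth v j) | j < l] (tnth u i) | i < n] =
    [tuple tnth b (tnth [tuple tnth v (tnth u i) | i < n] i) | i < n].
  by apply: eq_from_tnth => j; rewrite !tnth_mktuple.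
rewrite tupleE; apply: (aP (AtomRel [tuple tnth v (tnth u i) | i < n])).
apply/forall_inP => b /(forall_inP vP) /(forall_inP uP) /=.
by rewrite tupleE.
Qed.

Lemma equivalence_class_eq (r s : relation_on A) :
  rel_equivalent r s -> equivalence_class r = equivalence_class s.
Proof.
move=> [rs sr]; apply/seteqP; split=> t [ct [h1 h2]]; split=> //; split;
  by [apply: definable_trans sr _ | apply: definable_trans _ rs
     |apply: definable_trans rs _ | apply: definable_trans _ sr].
Qed.

(** One direction of definability suffices, because equality of invariants is
    symmetric. *)
Lemma finitely_many_of_invariant (T : finType) (inv : relation_on A -> T) :
  (forall r s, compatible (tuples r) -> compatible (tuples s) ->
     inv r = inv s -> conjunct_atomic_definable (tuples r) (tuples s)) ->
  admits_finitely_many_relations A.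
Proof.
move=> invP; pose pickr (t : T) : option (relation_on A) :=
  match pselect (exists r, compatible (tuples r) /\ inv r = t) with
  | left ex => Some (projT1 (cid ex)) | right _ => None end.
pose F (t : T) := oapp (@equivalence_class _ A) classical_sets.set0 (pickr t).
apply: (@sub_finite_set _ _ [set F t | t in classical_sets.setT]%classic); last first.
  by apply: finite_image; exact: finite_finset.
move=> _ [r cr <-]; exists (inv r) => //; rewrite /F /pickr.
case: pselect => [ex|]; last by case; exists r.
case: cid => s [cs e] /=.
by apply: equivalence_class_eq; split; apply: invP.
Qed.

Lemma infinitely_many_of_sequence (r : nat -> relation_on A) :
  (forall n, compatible (tuples (r n))) ->
  (forall m n, m < n -> ~ conjunct_atomic_definable (tuples (r n)) (tuples (r m))) ->
  ~ admits_finitely_many_relations A.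
Proof.
move=> rC rN fin; apply: infinite_nat.
have inj : injective (fun n => equivalence_class (r n)).
  move=> m n e.
  have: equivalence_class (r n) (r n).
    by split; [exact: rC | split; apply: definable_refl].
  rewrite -e => -[_ [mn nm]].
  by case: (ltngtP m n) => // [/rN|/rN].
apply: sub_finite_set (finite_preimage _ fin) => [n _ /=|m n _ _]; last exact: inj.
by exists (r n) => //; exact: rC.
Qed.

End Definability.

(** * Duality for finite Ockham algebras *)

Section Duality.
Variables (d : Order.disp_t) (A : finOckhamType d).
Local Open Scope order_scope.
Implicit Types (x y : dual_carrier A) (a b c : A).

Lemma dual_bot x : sval x \bot = false.
Proof. by case: x => x /= /and4P[/eqP]. Qed.

Lemma dual_top x : sval x \top = true.
Proof. by case: x => x /= /and4P[_ /eqP]. Qed.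

Lemma dual_join x a b : sval x (a `|` b) = sval x a || sval x b.
Proof. by case: x => x /= /and4P[_ _ /forallP/(_ a)/forallP/(_ b)/eqP]. Qed.

Lemma dual_meet x a b : sval x (a `&` b) = sval x a && sval x b.
Proof. by case: x => x /= /and4P[_ _ _ /forallP/(_ a)/forallP/(_ b)/eqP]. Qed.

Lemma dual_oneg x a : sval x (oneg a) = ~~ sval (dual_g x) a.
Proof. by rewrite ffunE negbK. Qed.

Lemma dual_leP x y : reflect (forall a, sval x a -> sval y a) (x <= y).
Proof.
apply: (iffP forallP) => xy a; move: (xy a); first by case: (sval x a); case: (sval y a).
by case: (sval x a) (sval y a) => -[] //; apply.
Qed.

(** A minimal element p below a and not below b is join-prime: if p lies below
    a join, it is the join of its meets with the two parts, and by minimality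
    these cannot both be strictly below p.  Its principal filter is the
    required homomorphism. *)
Lemma dual_separation a b : ~~ (a <= b) -> exists x, sval x a && ~~ sval x b.
Proof.
move=> ab; pose P := [pred p | (p <= a) && ~~ (p <= b)].
have Pa : P a by rewrite /= lexx.
pose D (p : A) := #|[set q | q <= p]|.
case: (arg_minnP D Pa) => p /andP[pa pb] pmin.
have below c : c <= p -> c != p -> c <= b.
  move=> cp ncp; apply/negPn/negP => cb.
  have: (D p <= D c)%N by apply: pmin; rewrite /= cb (le_trans cp pa).
  rewrite leqNgt => /negP; apply; apply: proper_card; apply/properP; split.
by apply/fintype.subsetP => q; rewrite !inE => qc; apply: le_trans cp.
  by exists p; rewrite ?inE ?lexx //; apply/negP => pc; case/eqP: ncp; apply: le_anti; rewrite cp.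
have hom : is_bounded_lattice_hom [ffun c => p <= c].
  apply/and4P; split; rewrite ?ffunE.
  - by apply/eqP/negP => p0; case/negP: pb; apply: le_trans p0 (le0x _).
  - by rewrite lex1.
  - apply/'forall_forallP => c c'; rewrite !ffunE; apply/eqP; apply/idP/idP; last first.
      by case/orP => h; apply: le_trans h _; rewrite ?leUl ?leUr.
    move=> pcc; apply/negPn/negP; rewrite negb_or => /andP[pc pc'].
    case/negP: pb; have -> : p = (p `&` c) `|` (p `&` c').
      by rewrite -meetUr; apply/esym/meet_idPl.
    by rewrite leUx !below ?leIl //; apply/eqP => /meet_idPl; apply/negP.
  - by apply/'forall_forallP => c c'; rewrite !ffunE lexI.
pose x : dual_carrier A := exist _ [ffun c => p <= c] hom; exists x; rewrite /= !ffunE pa /=.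
exact: pb.
Qed.

Lemma dual_separates a b : (forall x, sval x a = sval x b) -> a = b.
Proof.
move=> ab; apply: le_anti; apply/andP; split; apply/negPn/negP => /dual_separation[x].
  by rewrite ab andbN.
by rewrite ab andbN.
Qed.

(** The join, over the points x of the up-set, of the least element that x maps
    to 1. *)
Lemma upset_represented (U : dual_carrier A -> bool) :
  (forall x y, x <= y -> U x -> U y) -> exists a, forall x, sval x a = U x.
Proof.
move=> Umono; pose principal x := \meet_(c | sval x c) c.
have meetE x (P : pred A) : sval x (\meet_(c | P c) c) = [forall (c | P c), sval x c].
  rewrite -big_andE.
  by apply: (big_morph (sval x) (dual_meet x) (dual_top x)).
have principalE x y : sval y (principal x) = (x <= y).
  by rewrite /principal meetE; apply/forall_inP/dual_leP.
exists (\join_(x | U x) principal x) => y.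
rewrite (big_morph (sval y) (dual_join y) (dual_bot y)) big_orE.
apply/exists_inP/idP => [[x Ux]|Uy]; last by exists y; rewrite ?principalE.
by rewrite principalE => xy; apply: Umono Ux.
Qed.

Lemma dual_inhabited : (1 < #|A|)%N -> exists x : dual_carrier A, True.
Proof.
move=> /card_gt1P[a [b [_ _ ab]]]; apply: contrapT => no.
by case/eqP: ab; apply: dual_separates => x; case: no; exists x.
Qed.

End Duality.

(** * Anchored paths of compatible relations *)

Section Paths.
Variables (d : Order.disp_t) (A : finOckhamType d).

Definition compatible2 (rho : rel A) : Prop :=
  [/\ rho \bot%O \bot%O, rho \top%O \top%O,
      forall x y x' y', rho x y -> rho x' y' -> rho (x `|` x')%O (y `|` y')%O,
      forall x y x' y', rho x y -> rho x' y' -> rho (x `&` x')%O (y `&` y')%O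
    & forall x y, rho x y -> rho (oneg x) (oneg y)].

Lemma compatible2_diagonal (rho : rel A) :
  compatible2 rho -> compatible2 (fun x _ => rho x x).
Proof.
case=> r0 r1 rU rI rN; split=> // [x _ x' _|x _ x' _|x _].
- exact: rU.
- exact: rI.
- exact: rN.
Qed.

Variables (alpha : pred A) (rho : bool -> rel A).

(** Infinite walks are used as witnesses for all path lengths at once; the
    parity allows two different links to alternate. *)
Definition walk (F : nat -> A) : Prop :=
  alpha (F 0) /\ forall i, rho (odd i) (F i) (F i.+1).

Definition walks n : {set n.+1.-tuple A} :=
  [set a : n.+1.-tuple A | alpha (tnth a ord0) &&
    [forall i : 'I_n.+1, forall j : 'I_n.+1,
       (j == i.+1 :> nat) ==> rho (odd i) (tnth a i) (tnth a j)]].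

Lemma walksP n (a : n.+1.-tuple A) :
  reflect (alpha (tnth a ord0) /\
           forall i j : 'I_n.+1, j = i.+1 :> nat -> rho (odd i) (tnth a i) (tnth a j))
    (a \in walks n).
Proof.
rewrite inE; apply: (iffP andP) => -[al rP]; split=> //.
  by move=> i j /eqP ij; apply: (implyP (forallP (forallP rP i) j)).
by apply/forallP => i; apply/forallP => j; apply/implyP => /eqP; apply: rP.
Qed.

Lemma mem_walks n F : walk F -> [tuple F i | i < n.+1] \in walks n.
Proof.
case=> al rP; apply/walksP; split=> [|i j ij]; rewrite !tnth_mktuple //.
by rewrite ij.
Qed.

Lemma walks_compatible n :
  compatible2 (fun x _ => alpha x) -> (forall e, compatible2 (rho e)) ->
  compatible (walks n).
Proof.
move=> [a0 a1 aU aI aN] rC.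
have sub : subuniverse (walks n).
  split.
  - by apply/walksP; split=> [|i j _]; rewrite !tnth_mktuple //; case: (rC (odd i)).
  - by apply/walksP; split=> [|i j _]; rewrite !tnth_mktuple //; case: (rC (odd i)).
  - move=> a b /walksP[aa ar] /walksP[ba br]; apply/walksP.
    split=> [|i j ij]; rewrite !tnth_mktuple; first exact: (aU _ \bot%O _ \bot%O).
    by have [_ _ rU _ _] := rC (odd i); apply: rU; [apply: ar | apply: br].
  - move=> a b /walksP[aa ar] /walksP[ba br]; apply/walksP.
    split=> [|i j ij]; rewrite !tnth_mktuple; first exact: (aI _ \bot%O _ \bot%O).
    by have [_ _ _ rI _] := rC (odd i); apply: rI; [apply: ar | apply: br].
  - move=> a /walksP[aa ar]; apply/walksP.
    split=> [|i j ij]; rewrite !tnth_mktuple; first exact: (aN _ \bot%O).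
    by have [_ _ _ _ rN] := rC (odd i); apply: rN; apply: ar.
by split=> //; exists [tuple \bot%O | _ < n.+1]; case: sub.
Qed.

Hypothesis anchored : forall i, 0 < i -> exists2 F, walk F & ~~ alpha (F i).
Hypothesis no_skip : forall e i j, i.+1 < j ->
  exists2 F, walk F & ~~ rho e (F i) (F j).
Hypothesis distinct : forall i j, i < j -> exists2 F, walk F & F i != F j.
Hypothesis last_step : forall i, exists2 F, walk F & exists c, ~~ rho (odd i) (F i) c.

(** A valid atom has to send its first variable to the anchored one, and
    consecutive variables to variables at most one step further on. *)
Lemma valid_walk_bound m n (v : m.+1.-tuple 'I_n.+1) :
  valid (walks n) (walks m) (AtomRel v) -> forall i : 'I_m.+1, tnth v i <= i.
Proof.
move=> vP.
have walkv F : walk F ->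
    alpha (F (tnth v ord0)) /\
    forall i j : 'I_m.+1, j = i.+1 :> nat -> rho (odd i) (F (tnth v i)) (F (tnth v j)).
  move=> /(@mem_walks n) /(forall_inP vP) /walksP[].
  rewrite !tnth_mktuple => al rP; split=> // i j /rP.
  by rewrite !tnth_mktuple.
case; elim=> [|i IH] lti.
  rewrite leqNgt; apply/negP => /anchored[F /walkv[al _]] /negP; apply.
  by congr (alpha (F (tnth v _))): al; apply: val_inj.
have lti' : i < m.+1 by apply: ltnW.
rewrite leqNgt; apply/negP => lt.
have {}lt : (tnth v (Ordinal lti')).+1 < tnth v (Ordinal lti).
  by apply: leq_trans lt; rewrite !ltnS IH.
have [F /walkv[_ rP]] := no_skip (odd i) lt.
by rewrite (rP (Ordinal lti') (Ordinal lti)).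
Qed.

(** The atoms valid on the longer path do not mention its last variable, so they
    cannot tell a walk from the tuple in which its last entry is spoilt. *)
Lemma walks_not_definable m n :
  m < n -> ~ conjunct_atomic_definable (walks n) (walks m).
Proof.
case: n => // n mn /definableP def.
have [F Fw [c cP]] := last_step n.
pose a := [tuple if i == n.+1 :> nat then c else F i | i < n.+2].
suff: a \in walks n.+1.
  case/walksP => _ /(_ (inord n) ord_max); rewrite !tnth_mktuple inordK //= eqxx.
  by rewrite ltn_eqF //= => /(_ erefl) /negP; apply; apply/negPn.
apply: def => -[i j|v] vP /=.
  case: (eqVneq i j) => [->//|ij].
  have far G : walk G -> G i = G j.
    move=> /(@mem_walks n.+1) /(forall_inP vP) /=.
    by rewrite !tnth_mktuple => /eqP.
  case: (ltngtP i j) => [/distinct[G /far->]|/distinct[G /far->]|/val_inj e].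
  - by rewrite eqxx.
  - by rewrite eqxx.
  - by rewrite e eqxx in ij.
suff -> : [tuple tnth a (tnth v j) | j < m.+1] =
          [tuple tnth [tuple F i | i < n.+2] (tnth v j) | j < m.+1].
  by apply: (forall_inP vP); apply: mem_walks.
apply: eq_from_tnth => i; rewrite !tnth_mktuple ltn_eqF //.
by apply: leq_ltn_trans (valid_walk_bound vP i) _; apply: leq_ltn_trans mn; rewrite -ltnS.
Qed.

Lemma infinitely_many_of_walks :
  compatible2 (fun x _ => alpha x) -> (forall e, compatible2 (rho e)) ->
  ~ admits_finitely_many_relations A.
Proof.
move=> aC rC.
pose r n := RelationOn (ltn0Sn n) (walks n).
apply: (@infinitely_many_of_sequence _ _ r) => [n|m n]; first exact: walks_compatible.
exact: walks_not_definable.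
Qed.

End Paths.

Section Fences.
Variables (d : Order.disp_t) (A : finOckhamType d) (alpha : pred A) (rho : rel A).

(** With these links, the even places of a walk are upper ends and the odd
    places lower ends of a fence. *)
Definition fence_rel (e : bool) : rel A := fun x y => if e then rho x y else rho y x.

(** The up-set generated by place i in the fence. *)
Definition fence_up (i l : nat) := (l == i) || odd i && ((l == i.+1) || (l.+1 == i)).

Lemma fence_walk (up : pred nat) w v v' :
  alpha w -> alpha v' -> rho w w -> rho v w -> rho v v -> rho v v' ->
  (forall i, odd i -> up i -> up i.+1 && up i.-1) ->
  walk alpha fence_rel (fun l => if up l then w else if l == 0 then v' else v).
Proof.
move=> aw av' ww vw vv vv' upP; split=> [|i]; first by case: ifP.
rewrite /fence_rel; case: ifP => oi.
  have := upP i oi; case: (up i) => [/(_ isT)/andP[-> _] //|_].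
  by case: i oi => // i _; case: ifP.
have /= := upP i.+1; rewrite oi; case: (up i.+1) => [/(_ isT isT)/andP[_ ->] //|_].
by case: (up i) => //; case: i oi.
Qed.

Lemma fence_upP i j : odd j -> fence_up i j -> fence_up i j.+1 && fence_up i j.-1.
Proof.
move=> oj; rewrite /fence_up => /orP[/eqP <-|].
  by rewrite oj !eqxx orbT /= prednK ?odd_gt0 // eqxx !orbT.
by case/andP => oi /orP[/eqP e|/eqP e]; move: oj oi; [rewrite e | rewrite -e] => /=; case: odd.
Qed.

(** Placing p at the anchor and q elsewhere separates the anchor from the other
    places.  Placing w on the up-set of place i, and v elsewhere except for v' at
    the anchor, shows that only the neighbours of i can be comparable with it. *)
Lemma infinitely_many_of_fence p q w v v' :
  compatible2 (fun x _ => alpha x) -> compatible2 rho ->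
  [/\ alpha p, ~~ alpha q, rho q p & rho q q] ->
  [/\ alpha w, alpha v', rho w w & rho v v] ->
  [/\ rho v w, rho v v', ~~ rho w v & ~~ rho w v'] ->
  ~ admits_finitely_many_relations A.
Proof.
move=> aC rC [ap aq qp qq] [aw av' ww vv] [vw vv' wv wv'].
have fw := fence_walk aw av' ww vw vv vv'.
have wnv : w != v by apply: contraNneq wv => <-.
have wnv' : w != v' by apply: contraNneq wv' => <-.
pose G i l := if fence_up i l then w else if l == 0 then v' else v.
have Gw i : walk alpha fence_rel (G i) by apply: fw; apply: fence_upP.
have Gi i : G i i = w by rewrite /G /fence_up eqxx.
have Gneq i l : ~~ fence_up i l -> ~~ rho w (G i l).
  by rewrite /G => /negPf ->; case: ifP.
have upN i l : i.+1 < l -> ~~ fence_up i l.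
  by move=> il; rewrite /fence_up !gtn_eqF ?andbF // ltnW // ltnW.
have upN' i l : l.+1 < i -> ~~ fence_up i l.
  by move=> il; rewrite /fence_up !ltn_eqF ?andbF // ltnW // ltnW.
apply: (@infinitely_many_of_walks _ _ alpha fence_rel) => //; last first.
- by move=> [] //=; case: rC => r0 r1 rU rI rN; split=> //= *;
    by [apply: rU | apply: rI | apply: rN].
- move=> i; case oi: (odd i).
    exists (fun=> w); first by split=> // j; rewrite /fence_rel; case: ifP.
    by exists v; rewrite /fence_rel.
  exists (fun l => if l == 0 then v' else v); first exact: (fw pred0).
  by exists w; rewrite /fence_rel; case: ifP.
- move=> i j ij; have [up|up] := boolP (fence_up i j).
    have up' : ~~ fence_up j i.
      move: up; rewrite /fence_up gtn_eqF //= => /andP[oi /orP[/eqP ->|/eqP e]].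
        by rewrite /= oi ltn_eqF.
      by rewrite -e ltnNge leqnSn in ij.
    exists (G j) => //; rewrite Gi; apply: contraNneq (Gneq _ _ up') => ->.
    exact: ww.
  by exists (G i) => //; rewrite Gi; apply: contraNneq (Gneq _ _ up) => <-.
- move=> [] i j ij.
    by exists (G i) => //; rewrite /fence_rel Gi; apply: Gneq; apply: upN.
  by exists (G j) => //; rewrite /fence_rel Gi; apply: Gneq; apply: upN'.
- move=> i i0; exists (fun l => if l == 0 then p else q); last by rewrite gtn_eqF.
  split=> // -[|j] //=; rewrite /fence_rel; case: ifP => //.
Qed.

End Fences.

(** * Relations lifted from a divisor of the dual space *)

Section Constraints.
Variable Y : ockham_space.

(** ((e, p), (e', q)) stands for the inequality between the value at p of the
    first (e = false) or second (e = true) variable and the value at q of the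
    variable selected by e'. *)
Definition constraint : Type := ((bool * Y) * (bool * Y))%type.

Definition constraints_closed (C : seq constraint) : bool :=
  all (fun c => ((c.2.1, os_g c.2.2), (c.1.1, os_g c.1.2)) \in C) C.

Definition satisfies (C : seq constraint) (b b' : Y -> bool) : bool :=
  all (fun c => (if c.1.1 then b' else b) c.1.2 ==>
                (if c.2.1 then b' else b) c.2.2) C.

Definition monotone (b : Y -> bool) : Prop := forall p q, (p <= q)%O -> b p ==> b q.

Variables (d : Order.disp_t) (A : finOckhamType d).
Variables (S : {set dual_space A}) (S_closed : os_closed S).
Variables (h : os_sub S_closed -> Y).
Hypothesis h_morphism : os_morphism h.
Hypothesis h_surjective : forall y, exists s, h s = y.

Let ev (s : os_sub S_closed) (a : A) : bool := sval (sval s : dual_carrier A) a.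

(** A constraint between p and q is imposed on all points in the fibres of h
    over p and q, which makes it meaningful for every element of A. *)
Definition constrained (C : seq constraint) : rel A := fun x y =>
  all (fun c : constraint => [forall s, forall t,
    (h s == c.1.2) ==> (h t == c.2.2) ==>
    ev s (if c.1.1 then y else x) ==> ev t (if c.2.1 then y else x)]) C.

Lemma constrainedP C x y :
  reflect (forall c : constraint, c \in C -> forall s t, h s = c.1.2 -> h t = c.2.2 ->
     ev s (if c.1.1 then y else x) -> ev t (if c.2.1 then y else x))
    (constrained C x y).
Proof.
apply: (iffP allP) => cP c cC.
  move=> s t /eqP hs /eqP ht.
  have /forallP/(_ s)/forallP/(_ t)/implyP/(_ hs)/implyP/(_ ht)/implyP := cP c cC.
  exact.
apply/forallP => s; apply/forallP => t.
by apply/implyP => /eqP hs; apply/implyP => /eqP ht; apply/implyP; apply: cP.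
Qed.

(** Negation exchanges the two sides of an inequality and applies g to the
    points, hence the closure condition. *)
Lemma constrained_compatible C : constraints_closed C -> compatible2 (constrained C).
Proof.
move=> /allP Cc; split.
- by apply/constrainedP => c _ s t _ _; rewrite if_same /ev dual_bot.
- by apply/constrainedP => c _ s t _ _ _; rewrite if_same /ev dual_top.
- move=> x y x' y' /constrainedP xy /constrainedP xy'; apply/constrainedP => c cC s t hs ht.
  have := xy c cC s t hs ht; have := xy' c cC s t hs ht; rewrite /ev.
  by case: c.1.1; case: c.2.1; rewrite !dual_join => i j /orP[/j->|/i->]; rewrite ?orbT.
- move=> x y x' y' /constrainedP xy /constrainedP xy'; apply/constrainedP => c cC s t hs ht.
  have := xy c cC s t hs ht; have := xy' c cC s t hs ht; rewrite /ev.
  by case: c.1.1; case: c.2.1; rewrite !dual_meet => i j /andP[/j-> /i->].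
move=> x y /constrainedP xy; apply/constrainedP => c cC s t hs ht.
have := xy _ (Cc c cC) (os_g t) (os_g s).
rewrite !(proj2 h_morphism) hs ht => /(_ erefl erefl); rewrite /ev /=.
by case: c.1.1; case: c.2.1; rewrite !dual_oneg; apply: contraNN.
Qed.

(** The up-set of the dual space generated by the points of S where b composed
    with h is true meets S in exactly these points. *)
Lemma monotone_realized b : monotone b -> exists a, forall s, ev s a = b (h s).
Proof.
move=> bmono.
pose U (x : dual_carrier A) := [exists s : os_sub S_closed, (sval s <= x)%O && b (h s)].
have [x y xy /existsP[s /andP[sx bs]]|a aP] := @upset_represented _ _ U.
  by apply/existsP; exists s; rewrite bs (le_trans sx xy).
exists a => s; rewrite /ev aP; apply/existsP/idP => [[t /andP[ts bt]]|bs].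
  by apply: (implyP (bmono _ _ _)) bt; apply: (proj1 h_morphism).
by exists s; rewrite lexx.
Qed.

Lemma constrained_realized C a a' b b' :
  (forall s, ev s a = b (h s)) -> (forall s, ev s a' = b' (h s)) ->
  constrained C a a' = satisfies C b b'.
Proof.
move=> ab ab'; apply/constrainedP/allP => cP c cC; last first.
  move=> s t hs ht; have := cP c cC; rewrite -hs -ht => /implyP.
  by case: c.1.1; case: c.2.1; rewrite ?ab ?ab'.
have [s hs] := h_surjective c.1.2; have [t ht] := h_surjective c.2.2.
apply/implyP; have := cP c cC s t hs ht; rewrite -hs -ht.
by case: c.1.1; case: c.2.1; rewrite ?ab ?ab'.
Qed.

End Constraints.

Lemma infinitely_many_of_divisor_fence (Y : ockham_space) (Ca C : seq (constraint Y))
    (p q w v v' : Y -> bool) d (A : finOckhamType d) :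
  constraints_closed Ca -> constraints_closed C ->
  [/\ monotone p, monotone q, monotone w, monotone v & monotone v'] ->
  [/\ satisfies Ca p p, ~~ satisfies Ca q q, satisfies C q p & satisfies C q q] ->
  [/\ satisfies Ca w w, satisfies Ca v' v', satisfies C w w & satisfies C v v] ->
  [/\ satisfies C v w, satisfies C v v', ~~ satisfies C w v & ~~ satisfies C w v'] ->
  os_divisor Y (dual_space A) -> ~ admits_finitely_many_relations A.
Proof.
move=> Cac Cc [pm qm wm vm vm'] H1 H2 H3 [S [Sc [h [hm hs]]]].
have real b := @monotone_realized Y d A S Sc h hm b.
have [ap pE] := real p pm; have [aq qE] := real q qm; have [aw wE] := real w wm.
have [av vE] := real v vm; have [av' vE'] := real v' vm'.
have cE D := fun a a' b b' => @constrained_realized Y d A S Sc h hs D a a' b b'.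
apply: (@infinitely_many_of_fence _ A (fun x => constrained h Ca x x) (constrained h C)
         ap aq aw av av').
- exact: compatible2_diagonal (constrained_compatible hm Cac).
- exact: constrained_compatible.
- by rewrite (cE _ _ _ _ _ pE pE) (cE _ _ _ _ _ qE qE) (cE _ _ _ _ _ qE pE) (cE _ _ _ _ _ qE qE).
- by rewrite (cE _ _ _ _ _ wE wE) (cE _ _ _ _ _ vE' vE') (cE _ _ _ _ _ wE wE) (cE _ _ _ _ _ vE vE).
- by rewrite (cE _ _ _ _ _ vE wE) (cE _ _ _ _ _ vE vE') (cE _ _ _ _ _ wE vE) (cE _ _ _ _ _ wE vE').
Qed.

(** * The eight obstructions *)

Section EightSpaces.
Variables (d : Order.disp_t) (A : finOckhamType d).

(** An order-preserving map is given by the list of its values; the values of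
    the five maps p, q, w, v, v' are what the proofs below have to supply. *)
Definition on_ord n (b : bitseq) : 'I_n -> bool := fun i => nth false b i.

Local Notation elt n i := (@Ordinal n i isT).
Local Notation le_xx n i j := ((false, elt n i), (false, elt n j)).
Local Notation le_xy n i j := ((false, elt n i), (true, elt n j)).
Local Notation le_yx n i j := ((true, elt n i), (false, elt n j)).

Lemma antichain_monotone (b : bitseq) :
  forall p q : antichain 2, (p <= q)%O -> on_ord b p ==> on_ord b q.
Proof. by move=> p q /eqP ->; apply: implybb. Qed.

Lemma ord2_monotone (b : bitseq) : (nth false b 0 ==> nth false b 1) ->
  forall p q : 'I_2, (p <= q)%O -> on_ord b p ==> on_ord b q.
Proof. by rewrite /on_ord => b01; case=> [[|[|?]] ?] // [[|[|?]] ?] //= _; apply: implybb. Qed.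

Lemma ord3_monotone (b : bitseq) :
  (nth false b 0 ==> nth false b 1) -> (nth false b 1 ==> nth false b 2) ->
  forall p q : 'I_3, (p <= q)%O -> on_ord b p ==> on_ord b q.
Proof.
rewrite /on_ord => b01 b12; case=> [[|[|[|?]]] ?] // [[|[|[|?]]] ?] //= _; rewrite ?implybb //.
by apply/implyP => /(implyP b01) /(implyP b12).
Qed.

Lemma ord3_antitone (b : bitseq) :
  (nth false b 1 ==> nth false b 0) -> (nth false b 2 ==> nth false b 1) ->
  forall p q : 'I_3, (q <= p)%O -> on_ord b p ==> on_ord b q.
Proof.
rewrite /on_ord => b10 b21; case=> [[|[|[|?]]] ?] // [[|[|[|?]]] ?] //= _; rewrite ?implybb //.
by apply/implyP => /(implyP b21) /(implyP b10).
Qed.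

(** The variables share their value t at 1.  The fence is made of their values
    at 0, and the anchor is kept above t. *)
Lemma infinitely_many_of_Y2 :
  os_divisor Y2 (dual_space A) -> ~ admits_finitely_many_relations A.
Proof.
apply: (@infinitely_many_of_divisor_fence Y2
  [:: le_xx 2 1 0; le_xx 2 1 1] [:: le_xy 2 0 0; le_yx 2 1 1; le_xy 2 1 1]
  (on_ord [:: true; true]) (on_ord [:: false; true])
  (on_ord [:: true; false]) (on_ord [:: false; false]) (on_ord [:: false; false])).
1-2: by []. 2-4: by [].
by split; apply: antichain_monotone.
Qed.

(** The algebra is the three-element chain, read as partial truth values: rho
    says that y is at least as defined as x, and the anchor is totally
    defined. *)
Lemma infinitely_many_of_Y3 :
  os_divisor Y3 (dual_space A) -> ~ admits_finitely_many_relations A.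
Proof.
apply: (@infinitely_many_of_divisor_fence Y3
  [:: le_xx 2 1 0] [:: le_xy 2 0 0; le_yx 2 1 1]
  (on_ord [:: true; true]) (on_ord [:: false; true])
  (on_ord [:: true; true]) (on_ord [:: false; true]) (on_ord [:: false; false])).
1-2: by []. 2-4: by [].
by split; apply: ord2_monotone.
Qed.

(** Where the common value at 2 is true, this is the situation of Y3. *)
Lemma infinitely_many_of_Y4 :
  os_divisor Y4 (dual_space A) -> ~ admits_finitely_many_relations A.
Proof.
apply: (@infinitely_many_of_divisor_fence Y4
  [:: le_xx 3 1 0; le_xx 3 2 2]
  [:: le_xy 3 2 2; le_yx 3 2 2; le_xy 3 0 0; le_yx 3 1 1]
  (on_ord [:: true; true; true]) (on_ord [:: false; true; true])
  (on_ord [:: true; true; true]) (on_ord [:: false; true; true])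
  (on_ord [:: false; false; true])).
1-2: by []. 2-4: by [].
by split; apply: ord3_monotone.
Qed.

Lemma infinitely_many_of_Y4_op :
  os_divisor (os_op Y4) (dual_space A) -> ~ admits_finitely_many_relations A.
Proof.
apply: (@infinitely_many_of_divisor_fence (os_op Y4)
  [:: le_xx 3 0 1; le_xx 3 2 2]
  [:: le_xy 3 2 2; le_yx 3 2 2; le_xy 3 1 1; le_yx 3 0 0]
  (on_ord [:: true; true; false]) (on_ord [:: true; false; false])
  (on_ord [:: true; true; false]) (on_ord [:: true; false; false])
  (on_ord [:: false; false; false])).
1-2: by []. 2-4: by [].
by split; apply: ord3_antitone.
Qed.

(** If the common value t at 1 is true, only the value at 0 varies, and the
    anchor must be the top; if t is false, only the value at 2 varies, and the
    anchor is free.  The two cases provide p, q and w, v respectively. *)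
Lemma infinitely_many_of_Y5 :
  os_divisor Y5 (dual_space A) -> ~ admits_finitely_many_relations A.
Proof.
apply: (@infinitely_many_of_divisor_fence Y5
  [:: le_xx 3 1 0; le_xx 3 1 1]
  [:: le_xy 3 1 1; le_yx 3 1 1; le_xy 3 0 0; le_xy 3 2 2]
  (on_ord [:: true; true; true]) (on_ord [:: false; true; true])
  (on_ord [:: false; false; true]) (on_ord [:: false; false; false])
  (on_ord [:: false; false; false])).
1-2: by []. 2-4: by [].
by split; apply: ord3_monotone.
Qed.

(** As for Y5, except that g forces the values at 2 to be compared in the
    opposite sense to those at 0. *)
Lemma infinitely_many_of_Y6 :
  os_divisor Y6 (dual_space A) -> ~ admits_finitely_many_relations A.
Proof.
apply: (@infinitely_many_of_divisor_fence Y6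
  [:: le_xx 3 1 0; le_xx 3 1 1]
  [:: le_xy 3 1 1; le_yx 3 1 1; le_xy 3 0 0; le_yx 3 2 2]
  (on_ord [:: true; true; true]) (on_ord [:: false; true; true])
  (on_ord [:: false; false; false]) (on_ord [:: false; false; true])
  (on_ord [:: false; false; true])).
1-2: by []. 2-4: by [].
by split; apply: ord3_monotone.
Qed.

Lemma infinitely_many_of_Y6_op :
  os_divisor (os_op Y6) (dual_space A) -> ~ admits_finitely_many_relations A.
Proof.
apply: (@infinitely_many_of_divisor_fence (os_op Y6)
  [:: le_xx 3 0 1; le_xx 3 1 1]
  [:: le_xy 3 1 1; le_yx 3 1 1; le_yx 3 0 0; le_xy 3 2 2]
  (on_ord [:: false; false; false]) (on_ord [:: true; false; false])
  (on_ord [:: true; true; true]) (on_ord [:: true; true; false])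
  (on_ord [:: true; true; false])).
1-2: by []. 2-4: by [].
by split; apply: ord3_antitone.
Qed.

(** The values at 0 and 1 of all variables are linked into one infinite sequence,
    starting with those of variable 0: at 0 and then at 1 for even variables,
    the other way round for odd ones.  The entries switch from false to true
    between the two values of variable i. *)
Definition Y1_path (i l : nat) : bitseq :=
  if l < i then [:: false; false] else
  if i < l then [:: true; true] else [:: odd i; ~~ odd i].

(** All points of Y1 are fixed by g, so compatible relations only express
    equalities and no fence is available.  Instead the links alternately equate
    the values at 1 and at 0, and the anchor equates its own two values. *)
Lemma infinitely_many_of_Y1 :
  os_divisor Y1 (dual_space A) -> ~ admits_finitely_many_relations A.
Proof.
move=> [S [Sc [h [hm hs]]]].
have real (b : bitseq) : exists a : A, forall s : os_sub Sc,
    sval (sval s : dual_carrier A) a = @on_ord 2 b (h s).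
  exact: (monotone_realized hm (@antichain_monotone b)).
have [el elE] := choice real.
pose Ca : seq (constraint Y1) := [:: le_xx 2 0 1; le_xx 2 1 0].
pose C (e : bool) : seq (constraint Y1) :=
  if e then [:: le_xy 2 0 0; le_yx 2 0 0] else [:: le_xy 2 1 1; le_yx 2 1 1].
have cE D b b' : constrained h D (el b) (el b') = satisfies D (@on_ord 2 b) (@on_ord 2 b').
  exact: constrained_realized.
have caE b : constrained h Ca (el b) (el b) = (nth false b 0 == nth false b 1).
  by rewrite cE /satisfies /= /on_ord /=; case: (nth _ b 0); case: (nth _ b 1).
have ceE e b b' : constrained h (C e) (el b) (el b') =
    (nth false b (~~ e) == nth false b' (~~ e)).
  by rewrite cE /satisfies; case: e; rewrite /= /on_ord /=; case: (nth _ b _); case: (nth _ b' _).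
have pathW i : 0 < i ->
    walk (fun x => constrained h Ca x x) (fun e => constrained h (C e)) (fun l => el (Y1_path i l)).
  move=> i0; split=> [|l]; rewrite ?caE ?ceE /Y1_path ?i0 //.
  case: (ltngtP l.+1 i) => [//|li|<-].
    rewrite ltnS in li; rewrite /=; case: ltngtP li => //= -> _.
    by case: (odd l).
  by rewrite /=; case: (odd l).
apply: (@infinitely_many_of_walks _ _ (fun x => constrained h Ca x x)
          (fun e => constrained h (C e))).
- move=> i i0; exists (fun l => el (Y1_path i l)); first exact: pathW.
  by rewrite caE /Y1_path ltnn /=; case: (odd i).
- move=> e i j ij; exists (fun l => el (Y1_path i.+1 l)); first exact: pathW.
  by rewrite ceE /Y1_path ltnSn ltnNge ltnW //= ij; case: e.
- move=> i j ij; have j0 : 0 < j by apply: leq_ltn_trans ij.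
  exists (fun l => el (Y1_path j l)); first exact: pathW.
  have: ~~ constrained h (C (odd j)) (el (Y1_path j i)) (el (Y1_path j j)).
    by rewrite ceE /Y1_path ij ltnn; case: (odd j).
  apply: contraNneq => ->; by rewrite ceE.
- move=> i; exists (fun l => el (Y1_path i.+1 0)).
    by split=> [|l]; rewrite ?caE ?ceE.
  by exists (el (Y1_path 0 1)); rewrite ceE; case: (odd i).
- exact: compatible2_diagonal (constrained_compatible hm (C := Ca) isT).
- by move=> e; apply: constrained_compatible => //; case: e.
Qed.

End EightSpaces.

(** * Iterates of the map of an Ockham space *)

(** Divisors presented by a map on the whole space of which only the restriction
    to S matters; unlike [os_divisor], this can be transported along [os_op]
    without changing types. *)
Definition partial_divisor (Y X : ockham_space) : Prop :=
  exists (S : pred X) (h : X -> Y),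
    [/\ forall x, S x -> S (os_g x),
        forall x y, S x -> S y -> (x <= y)%O -> (h x <= h y)%O,
        forall x, S x -> h (os_g x) = os_g (h x)
      & forall p, exists2 x, S x & h x = p].

Lemma divisor_of_partial Y X : partial_divisor Y X -> os_divisor Y X.
Proof.
move=> [S [h [Sg hle hg hs]]].
have Sc : os_closed [set x : X | S x] by move=> x; rewrite !inE; apply: Sg.
exists [set x : X | S x], Sc, (fun x => h (sval x)); split.
  split=> [x y xy|x]; first by apply: hle xy; [have := svalP x | have := svalP y]; rewrite inE.
  by rewrite /= hg //; have := svalP x; rewrite inE.
move=> p; have [x Sx <-] := hs p.
by have xS : x \in [set x | S x] by [rewrite inE]; exists (exist _ x xS).
Qed.

Lemma partial_divisor_op Y X : partial_divisor Y (os_op X) -> partial_divisor (os_op Y) X.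
Proof.
move=> [S [h [Sg hle hg hs]]]; exists S, h; split=> // x y Sx Sy xy.
exact: hle.
Qed.

Lemma isomorphic_op Y X : os_isomorphic (os_op X) Y -> os_isomorphic X (os_op Y).
Proof.
move=> [h [k [[hle hg] [kle kg] hk kh]]]; exists h, k; split=> //; split=> // x y xy.
  exact: hle.
exact: kle.
Qed.

Lemma isomorphic_of_bijection (X Y : ockham_space) (f : Y -> X) :
  injective f -> (forall x, exists p, f p = x) ->
  (forall p q, (f p <= f q)%O = (p <= q)%O) -> (forall p, f (os_g p) = os_g (f p)) ->
  os_isomorphic X Y.
Proof.
move=> finj fsurj fle fg; have [k fk] := choice fsurj.
have kf : cancel f k by move=> p; apply: finj; rewrite fk.
exists k, f; split=> //; split=> //.
- by move=> x y xy; rewrite -fle !fk.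
- by move=> x; apply: finj; rewrite fg !fk.
- by move=> p q; rewrite fle.
Qed.

Section Iteration.
Variable X : ockham_space.
Implicit Types x y : X.
Local Notation g := (@os_g X).

Lemma iter_le n x y : (x <= y)%O ->
  if odd n then (iter n g y <= iter n g x)%O else (iter n g x <= iter n g y)%O.
Proof.
move=> xy; elim: n => //= n; case: (odd n) => /= h; exact: os_gP.
Qed.

Lemma iter_le_odd n x y : odd n -> (x <= y)%O -> (iter n g y <= iter n g x)%O.
Proof. by move=> on /(iter_le n); rewrite on. Qed.

Lemma iter_le_even n x y : ~~ odd n -> (x <= y)%O -> (iter n g x <= iter n g y)%O.
Proof. by move=> /negPf on /(iter_le n); rewrite on. Qed.

Lemma iter_periodic n k x : iter n g x = x -> iter (n * k) g x = x.
Proof. by move=> nx; rewrite mulnC; elim: k => //= k IH; rewrite mulSn iterD IH. Qed.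

Lemma iter_periodic_iter n k x : iter n g x = x -> iter n g (iter k g x) = iter k g x.
Proof. by move=> nx; rewrite -iterD addnC iterD nx. Qed.

Lemma iter_modn n m x : iter m g x = x -> iter (n %% m) g x = iter n g x.
Proof. by move=> mx; rewrite [in RHS](divn_eq n m) addnC iterD mulnC iter_periodic. Qed.

(** Every orbit enters its cycle after fewer than #|X| + 1 steps, and the length
    of the cycle divides the factorial of that number. *)
Lemma exists_idempotent_power :
  exists2 M, 0 < M & forall x, iter M g (iter M g x) = iter M g x.
Proof.
pose M := (#|X|.+1`! * #|X|.+1)%N.
have leM : #|X|.+1 <= M by rewrite leq_pmull ?fact_gt0.
exists M => [|x]; first exact: leq_trans leM.
have [i lti e] := trajectP (looping_order g x).
have ltX : order g x <= #|X| by apply: max_card.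
have pM : order g x - i %| M.
  apply: dvdn_mulr; apply: dvdn_fact; rewrite subn_gt0 lti /=.
  by apply: leq_trans (leq_subr _ _) _; apply: leqW.
have iM : i <= M.
  by apply: leq_trans leM; apply: leqW; apply: leq_trans ltX; apply: ltnW.
have per : iter (order g x - i) g (iter i g x) = iter i g x.
  by rewrite -iterD subnK 1?ltnW.
have perM : iter M g (iter i g x) = iter i g x.
  by case/dvdnP: pM => q ->; rewrite mulnC iter_periodic.
have -> : iter M g x = iter (M - i) g (iter i g x) by rewrite -iterD subnK.
exact: iter_periodic_iter.
Qed.

End Iteration.

Section OddCycles.
Variable X : ockham_space.
Implicit Types x y : X.
Local Notation g := (@os_g X).

(** Even powers preserve the order, so x is below g^u x, g^2u x, ..., and the
    chain closes up at g^uM x = x. *)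
Lemma even_iter_antichain M u x : 0 < M -> iter M g x = x -> ~~ odd u ->
  (x <= iter u g x)%O -> iter u g x = x.
Proof.
move=> M0 Mx ou xu; apply: le_anti; rewrite xu andbT.
have up n : (iter u g x <= iter (u * n.+1) g x)%O.
  elim: n => [|n IH]; first by rewrite muln1.
  apply: le_trans IH _; rewrite [in leRHS]mulnS addnC iterD.
  by apply: iter_le_even xu; rewrite oddM negb_and ou.
by have := up M.-1; rewrite prednK // mulnC iter_periodic.
Qed.

(** If no odd power fixes x, the points of its cycle have a parity.  All order
    relations between points of different parity point the same way, because
    two opposite ones could be chained, so the parity is a morphism onto Y3. *)
Lemma odd_cycle M x : 0 < M -> iter M g x = x -> ~ partial_divisor Y3 X ->
  exists2 n, odd n & iter n g x = x.
Proof.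
move=> M0 Mx noY3; apply: contrapT => noodd; apply: noY3.
have oM : ~~ odd M by apply/negP => oM; apply: noodd; exists M.
have parity a b : iter a g x = iter b g x -> odd a = odd b.
  move=> ab; apply/eqP; rewrite -[_ == _]negbK; apply/negP => nab.
  apply: noodd; exists (M * a - a + b)%N.
    rewrite oddD oddB ?leq_pmull // oddM (negPf oM) /=.
    by case: (odd a) (odd b) nab => -[].
  by rewrite iterD -ab -iterD subnK ?leq_pmull // iter_periodic.
(* The exponent M * i - i plays the role of -i, as M is an even period of x. *)
have step i j : exists2 u, odd u = odd i (+) odd j & iter u g (iter i g x) = iter j g x.
  exists (M * i - i + j)%N.
    by rewrite oddD oddB ?leq_pmull // oddM (negPf oM).
  by rewrite -iterD addnAC subnK ?leq_pmull // addnC iterD iter_periodic.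
have oneway i j k l : ~~ odd i -> odd j -> odd k -> ~~ odd l ->
    (iter i g x <= iter j g x)%O -> (iter k g x <= iter l g x)%O -> False.
  move=> oi oj ok ol ij kl.
  have [t ot te] := step k j.
  have {}ot : ~~ odd t by rewrite ot ok oj.
  have := iter_le_even ot kl; rewrite te -iterD => jt.
  have [u ou ue] := step i (t + l)%N.
  have ieq : iter u g (iter i g x) = iter i g x.
    apply: (even_iter_antichain M0); first exact: iter_periodic_iter.
      by rewrite ou oddD (negPf ot) (negPf ol) (negPf oi).
    by rewrite ue; apply: le_trans jt.
  have: iter i g x = iter j g x.
    by apply: le_anti; rewrite ij -ieq ue.
  by move/parity; rewrite oj (negPf oi).
pose odd_at y := odd (findex g x y).
have odd_atE i : odd_at (iter i g x) = odd i.
  by apply: parity; apply: iter_findex; apply: fconnect_iter.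
pose up := `[< exists i j, [/\ ~~ odd i, odd j & (iter i g x <= iter j g x)%O] >].
pose pt (b : bool) : Y3 := if b then @Ordinal 2 1 isT else @Ordinal 2 0 isT.
exists (fconnect g x), (fun y => pt (up (+) ~~ odd_at y)); split.
- by move=> y xy; apply: connect_trans xy (fconnect1 g y).
- move=> y z /iter_findex <- /iter_findex <-; rewrite !odd_atE.
  move: (findex _ _ y) (findex _ _ z) => i j ij.
  have [eo|neo] := eqVneq (odd i) (odd j); first by rewrite eo.
  have upE : up = ~~ odd i.
    apply/asboolP/idP => [[a [b [oa ob ab]]]|oi].
      apply/negP => oi; apply: (oneway a b i j) => //.
      by move: neo; rewrite oi; case: (odd j).
    by exists i, j; split=> //; move: neo; rewrite (negPf oi); case: (odd j).
  by rewrite upE; case: (odd i) (odd j) neo => -[].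
- move=> y /iter_findex <-; rewrite -iterS !odd_atE /=.
  by case: up; case: (odd _); apply/val_inj.
- have odd_at0 : odd_at x = false := odd_atE 0.
  have odd_at1 : odd_at (g x) = true := odd_atE 1.
  case=> [[|[|//]] ip].
    exists (if up then x else g x); first by case: ifP => _ //; apply: fconnect1.
    by apply/val_inj; case: (up); rewrite /= ?odd_at0 ?odd_at1.
  exists (if up then g x else x); first by case: ifP => _ //; apply: fconnect1.
  by apply/val_inj; case: (up); rewrite /= ?odd_at0 ?odd_at1.
Qed.

End OddCycles.

(** * Ockham spaces without the eight divisors *)

(** c generates the unique cycle of X, which has odd length m and is an
    antichain. *)
Definition is_core (X : ockham_space) (c : X) (m : nat) : Prop :=
  [/\ odd m, iter m os_g c = c,
      forall i j, i < m -> j < m -> iter i os_g c = iter j os_g c -> i = j,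
      forall y z, fconnect os_g c y -> fconnect os_g c z -> (y <= z)%O -> y = z
    & forall x, exists n, fconnect os_g c (iter n os_g x)].

Lemma is_core_op (X : ockham_space) (c : X) m :
  is_core c m -> is_core (c : os_op X) m.
Proof.
case=> om mc inj anti abs; split=> // y z cy cz zy.
by apply/esym/anti.
Qed.

(** For two periodic points some common odd power of g fixes both, and reverses
    any order relation between them: periodic points form an antichain.  Mapping
    one cycle to a point and the other periodic points to another would then
    give Y1. *)
Lemma core_exists (X : ockham_space) (x : X) :
  ~ partial_divisor Y1 X -> ~ partial_divisor Y3 X -> exists c m, @is_core X c m.
Proof.
move=> noY1 noY3; have [M M0 MM] := @exists_idempotent_power X.
pose K := [pred y : X | iter M os_g y == y].
have Kodd y : K y -> exists2 n, odd n & iter n os_g y = y.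
  by move=> /eqP yK; apply: odd_cycle yK noY3.
have Kg y : K y -> K (os_g y).
  by move=> /eqP yK /=; rewrite -iterSr iterS yK.
have Kanti y z : K y -> K z -> (y <= z)%O -> y = z.
  move=> /Kodd[n on yn] /Kodd[k ok zk] yz; apply: le_anti; rewrite yz /=.
  have /iter_le_odd/(_ yz) : odd (n * k) by rewrite oddM on.
  by rewrite (iter_periodic k yn) mulnC (iter_periodic n zk).
pose c := iter M os_g x.
have Kc : K c by apply/eqP/MM.
have Kconn y : K y -> fconnect os_g c y.
  move=> Ky; apply: contrapT => /negP cy; apply: noY1.
  pose pt (b : bool) : Y1 := if b then @Ordinal 2 1 isT else @Ordinal 2 0 isT.
  exists K, (fun z => pt (fconnect os_g c z)); split=> //.
  - by move=> u v Ku Kv /(Kanti _ _ Ku Kv) ->.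
  - move=> z /eqP Kz; have -> : fconnect os_g c (os_g z) = fconnect os_g c z.
      apply/idP/idP => [cz|]; last by move=> cz; apply: connect_trans cz (fconnect1 _ _).
      apply: connect_trans cz _; rewrite -{2}Kz -(prednK M0) iterSr.
      exact: fconnect_iter.
    by case: (fconnect os_g c z); apply/val_inj.
  - case=> [[|[|//]] ip].
      by exists y => //; rewrite (negPf cy); apply/val_inj.
    by exists c => //; rewrite connect0; apply/val_inj.
have ex : exists n, (0 < n) && (iter n os_g c == c) by exists M; rewrite M0.
case: (ex_minnP ex) => m /andP[m0 /eqP mc] mmin.
have small i : i < m -> iter i os_g c = c -> i = 0.
  move=> im ic; case: (posnP i) => // i0.
  by have := mmin i; rewrite i0 ic eqxx leqNgt im => /(_ isT).
have connK y : fconnect os_g c y -> K y.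
  by move=> /iter_findex <-; apply/eqP; apply: iter_periodic_iter; apply/eqP.
exists c, m; split=> //.
- have [n on nc] := Kodd c Kc; apply: dvdn_odd on; apply/eqP; apply: small.
    by rewrite ltn_pmod.
  by rewrite iter_modn.
- have aux i j : i <= j -> j < m -> iter i os_g c = iter j os_g c -> i = j.
    move=> ij jm e; apply/eqP; rewrite eqn_leq ij /= -subn_eq0; apply/eqP.
    apply: small; first by apply: leq_ltn_trans (leq_subr _ _) jm.
    (* Going once round the cycle from the common value returns to c. *)
    have im : i <= m by rewrite ltnW // (leq_ltn_trans ij).
    have : iter (m - i) os_g (iter i os_g c) = c by rewrite -iterD subnK.
    rewrite e -iterD; have -> : (m - i + j = (j - i) + m)%N by lia.
    by rewrite iterD mc.
  move=> i j im jm e; case: (leqP i j) => [ij|/ltnW ji]; first exact: aux.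
  by apply/esym/aux.
- by move=> y z /connK Ky /connK Kz; apply: Kanti.
- by move=> y; exists M; apply: Kconn; apply/eqP/MM.
Qed.

Section Tails.
Variables (X : ockham_space) (c : X) (m : nat).
Hypothesis core : is_core c m.
Local Notation g := (@os_g X).
Local Notation K := (fconnect g c).
Implicit Types x y k : X.

Let m_odd : odd m. Proof. by case: core. Qed.
Let m_gt0 : 0 < m. Proof. exact: odd_gt0. Qed.
Let c_periodic : iter m g c = c. Proof. by case: core. Qed.

Lemma core_g x : K x -> K (g x).
Proof. by move=> Kx; apply: connect_trans Kx (fconnect1 g x). Qed.

Lemma core_iter n x : K x -> K (iter n g x).
Proof. by move=> Kx; apply: connect_trans Kx (fconnect_iter g n x). Qed.

Lemma core_antichain x y : K x -> K y -> (x <= y)%O -> x = y.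
Proof. by case: core => _ _ _ anti _; apply: anti. Qed.

Lemma core_periodic x : K x -> iter m g x = x.
Proof. by move=> /iter_findex <-; apply: iter_periodic_iter. Qed.

Lemma core_g_inj x y : K x -> K y -> g x = g y -> x = y.
Proof.
move=> Kx Ky e; rewrite -(core_periodic Kx) -(core_periodic Ky).
by rewrite -(prednK m_gt0) !iterSr e.
Qed.

Lemma core_enum x : K x -> exists2 i, i < m & x = iter i g c.
Proof.
move=> /iter_findex; move: (findex _ _ _) => n <-; exists (n %% m); first by rewrite ltn_pmod.
by rewrite iter_modn.
Qed.

Lemma isomorphic_C : (forall x, K x) -> os_isomorphic X (space_C m).
Proof.
have [_ _ inj _ _] := core; move=> allK.
apply: (@isomorphic_of_bijection X (space_C m) (fun i => iter (nat_of_ord (i : 'I_m)) g c)).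
- by move=> i j /inj e; apply/val_inj/e; apply: ltn_ord.
- move=> x; have [i im ->] := core_enum (allK x).
  by exists (Ordinal im : 'I_m).
- move=> i j; apply/idP/eqP => [|->]; last exact: lexx.
  by move=> /(core_antichain (allK _) (allK _)) /inj e; apply/val_inj/e; apply: ltn_ord.
- by move=> i; rewrite /= iter_modn.
Qed.

(** For x outside the core with image in the core, this is the point of the core
    with the same image as x, by [twin_core] and [twin_g]. *)
Definition twin x := iter m g x.

Lemma twin_core x : K (g x) -> K (twin x).
Proof. by move=> Kgx; rewrite /twin -(prednK m_gt0) iterSr core_iter. Qed.

Lemma twin_g x : K (g x) -> g (twin x) = g x.
Proof. by move=> Kgx; rewrite /twin -iterS iterSr core_periodic. Qed.

(** Applying g to the comparison gives two comparable points of the core, which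
    therefore coincide. *)
Lemma core_below_twin x k : K (g x) -> K k -> (x <= k)%O -> k = twin x.
Proof.
move=> Kgx Kk /os_gP /(core_antichain (core_g Kk) Kgx); rewrite -(twin_g Kgx).
by apply: core_g_inj => //; apply: twin_core.
Qed.

Lemma core_above_twin x k : K (g x) -> K k -> (k <= x)%O -> k = twin x.
Proof.
move=> Kgx Kk /os_gP /(core_antichain Kgx (core_g Kk)); rewrite -(twin_g Kgx) => /esym.
by apply: core_g_inj => //; apply: twin_core.
Qed.

(** If x is comparable with no point of the core, sending the core to 1 and x to
    0 is a morphism onto Y2. *)
Lemma twin_comparable x : ~ partial_divisor Y2 X -> ~~ K x -> K (g x) ->
  (x <= twin x)%O || (twin x <= x)%O.
Proof.
move=> noY2 Kx Kgx; apply: contrapT => /negP; rewrite negb_or => /andP[xt tx]; apply: noY2.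
pose pt (b : bool) : Y2 := if b then @Ordinal 2 1 isT else @Ordinal 2 0 isT.
exists [pred y | K y || (y == x)], (fun y => pt (K y)); split.
- by move=> y /orP[/core_g|/eqP ->] /=; rewrite ?Kgx // => ->.
- move=> y z /= /orP[Ky|/eqP ->] /orP[Kz|/eqP ->]; rewrite ?Ky ?Kz ?(negPf Kx) //.
    by move=> yx; rewrite -(core_above_twin Kgx Ky yx) yx in tx.
  by move=> xz; rewrite -(core_below_twin Kgx Kz xz) xz in xt.
- move=> y /= /orP[Ky|/eqP ->]; last by rewrite Kgx (negPf Kx); apply/val_inj.
  by rewrite (core_g Ky) Ky; apply/val_inj.
- case=> [[|[|//]] ip].
    by exists x; rewrite /= ?eqxx ?orbT // (negPf Kx); apply/val_inj.
  by exists c; rewrite /= ?connect0 //; apply/val_inj.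
Qed.


Lemma below_twin_not_above x k : ~~ K x -> K (g x) -> (x <= twin x)%O -> K k ->
  (k <= x)%O = false.
Proof.
move=> Kx Kgx xt Kk; apply/negP => kx; case/negP: Kx.
suff <- : twin x = x by apply: twin_core.
by apply: le_anti; rewrite xt -(core_above_twin Kgx Kk kx) kx.
Qed.

Lemma above_twin_not_below x k : ~~ K x -> K (g x) -> (twin x <= x)%O -> K k ->
  (x <= k)%O = false.
Proof.
move=> Kx Kgx tx Kk; apply/negP => xk; case/negP: Kx.
suff <- : twin x = x by apply: twin_core.
by apply: le_anti; rewrite tx -(core_below_twin Kgx Kk xk) xk.
Qed.

(** The common shape of the remaining divisors: the core collapses to one point
    and two further points remain. *)
Lemma three_point_divisor (Y : ockham_space) (pK px py : Y) x y :
  ~~ K x -> ~~ K y -> y != x -> K (g x) ->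
  os_g pK = pK -> os_g px = pK ->
  (K (g y) /\ os_g py = pK) \/ (g y = x /\ os_g py = px) ->
  (forall k, K k -> ((x <= k)%O ==> (px <= pK)%O) && ((k <= x)%O ==> (pK <= px)%O)) ->
  (forall k, K k -> ((y <= k)%O ==> (py <= pK)%O) && ((k <= y)%O ==> (pK <= py)%O)) ->
  (x <= y)%O ==> (px <= py)%O -> (y <= x)%O ==> (py <= px)%O ->
  (forall p, [|| p == pK, p == px | p == py]) ->
  partial_divisor Y X.
Proof.
move=> Kx Ky yx Kgx gK gx gy xk yk /implyP xy /implyP yx' all3.
pose h z := if K z then pK else if z == x then px else py.
have hK z : K z -> h z = pK by rewrite /h => ->.
have hx : h x = px by rewrite /h (negPf Kx) eqxx.
have hy : h y = py by rewrite /h (negPf Ky) (negPf yx).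
exists [pred z | [|| K z, z == x | z == y]], h; split.
- move=> z /or3P[/core_g /= -> //|/eqP ->|/eqP ->] /=; first by rewrite Kgx.
  by case: gy => -[-> _] //; rewrite eqxx orbT.
- move=> u v /or3P[Ku|/eqP ->|/eqP ->] /or3P[Kv|/eqP ->|/eqP ->]; rewrite ?hx ?hy ?hK ?lexx //.
  + by case/andP: (xk _ Ku) => _ /implyP; apply.
  + by case/andP: (yk _ Ku) => _ /implyP; apply.
  + by case/andP: (xk _ Kv) => /implyP h1 _; exact: h1.
  + by case/andP: (yk _ Kv) => /implyP h1 _; exact: h1.
- move=> z /or3P[Kz|/eqP ->|/eqP ->]; first by rewrite !hK ?core_g.
    by rewrite hK // hx.
  by rewrite hy; case: gy => -[gyE ->]; [rewrite hK | rewrite gyE hx].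
- move=> p; case/or3P: (all3 p) => /eqP ->.
  + by exists c; rewrite /= ?connect0 ?hK.
  + by exists x; rewrite /= ?eqxx ?orbT.
  + by exists y; rewrite /= ?eqxx ?orbT.
Qed.

Lemma two_below_divisor x y : ~~ K x -> ~~ K y -> K (g x) -> K (g y) -> y != x ->
  (x <= twin x)%O -> (y <= twin y)%O -> partial_divisor Y4 X.
Proof.
move=> Kx Ky Kgx Kgy.
wlog nyx : x y Kx Ky Kgx Kgy / (y <= x)%O = false => [hw yx xt yt|yx xt yt].
  case nyx: (y <= x)%O; last exact: (hw x y).
  apply: (hw y x) => //; last by rewrite eq_sym.
  by apply/negP => xy; case/eqP: yx; apply: le_anti; rewrite nyx.
pose pt (i : 'I_3) : Y4 := i.
apply: (three_point_divisor (pK := pt (@Ordinal 3 2 isT)) (px := pt (@Ordinal 3 0 isT))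
          (py := pt (@Ordinal 3 1 isT)) Kx Ky yx Kgx).
- exact/val_inj.
- exact/val_inj.
- by left; split=> //; apply/val_inj.
- by move=> k Kk; rewrite (below_twin_not_above Kx Kgx xt Kk); apply/andP; split; apply/implyP.
- by move=> k Kk; rewrite (below_twin_not_above Ky Kgy yt Kk); apply/andP; split; apply/implyP.
- by apply/implyP.
- by rewrite nyx.
- by case=> [[|[|[|//]]] ip].
Qed.

Lemma below_and_above_divisor x y : ~~ K x -> ~~ K y -> K (g x) -> K (g y) ->
  (x <= twin x)%O -> (twin y <= y)%O -> partial_divisor Y5 X.
Proof.
move=> Kx Ky Kgx Kgy xt ty.
have nyx : (y <= x)%O = false.
  by apply/negP => yx; have := above_twin_not_below Ky Kgy ty (twin_core Kgx); rewrite (le_trans yx).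
have yx : y != x by apply/eqP => e; rewrite e lexx in nyx.
pose pt (i : 'I_3) : Y5 := i.
apply: (three_point_divisor (pK := pt (@Ordinal 3 1 isT)) (px := pt (@Ordinal 3 0 isT))
          (py := pt (@Ordinal 3 2 isT)) Kx Ky yx Kgx).
- exact/val_inj.
- exact/val_inj.
- by left; split=> //; apply/val_inj.
- by move=> k Kk; rewrite (below_twin_not_above Kx Kgx xt Kk); apply/andP; split; apply/implyP.
- by move=> k Kk; rewrite (above_twin_not_below Ky Kgy ty Kk); apply/andP; split; apply/implyP.
- by apply/implyP.
- by rewrite nyx.
- by case=> [[|[|[|//]]] ip].
Qed.

Lemma long_tail_divisor x y : ~~ K x -> K (g x) -> g y = x -> (x <= twin x)%O ->
  partial_divisor Y6 X.
Proof.
move=> Kx Kgx gy xt.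
have Ky : ~~ K y by apply: contra Kx => /core_g; rewrite gy.
have notbelow k : K k -> (y <= k)%O = false.
  by move=> Kk; apply/negP => /os_gP; rewrite gy (below_twin_not_above Kx Kgx xt (core_g Kk)).
have nyx : (y <= x)%O = false.
  by apply/negP => /os_gP; rewrite gy (below_twin_not_above Kx Kgx xt Kgx).
have yx : y != x by apply/eqP => e; rewrite e lexx in nyx.
pose pt (i : 'I_3) : Y6 := i.
apply: (three_point_divisor (pK := pt (@Ordinal 3 1 isT)) (px := pt (@Ordinal 3 0 isT))
          (py := pt (@Ordinal 3 2 isT)) Kx Ky yx Kgx).
- exact/val_inj.
- exact/val_inj.
- by right; split=> //; apply/val_inj.
- by move=> k Kk; rewrite (below_twin_not_above Kx Kgx xt Kk); apply/andP; split; apply/implyP.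
- by move=> k Kk; rewrite (notbelow k Kk); apply/andP; split; apply/implyP.
- by apply/implyP.
- by rewrite nyx.
- by case=> [[|[|[|//]]] ip].
Qed.

Lemma core_iter_inj z i j : K z -> i < m -> j < m -> iter i g z = iter j g z -> i = j.
Proof.
have [_ _ inj _ _] := core.
move=> /iter_findex <-; move: (findex _ _ _) => n im jm; rewrite -!iterD.
rewrite -(iter_modn (i + n) c_periodic) -(iter_modn (j + n) c_periodic).
by move=> /inj; rewrite !ltn_pmod // => /(_ isT isT) /eqP; rewrite eqn_modDr !modn_small // => /eqP.
Qed.

Lemma core_reach z y : K z -> K y -> exists2 i, i < m & y = iter i g z.
Proof.
move=> Kz /core_enum[j jm ->]; have [a am az] := core_enum Kz.
exists ((j + (m - a)) %% m); first by rewrite ltn_pmod.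
by rewrite iter_modn ?core_periodic // iterD az -(iterD (m - a)) subnK ?c_periodic // ltnW.
Qed.

Lemma isomorphic_D x : ~~ K x -> K (g x) -> (x <= twin x)%O ->
  (forall y, ~~ K y -> y = x) -> os_isomorphic X (space_D m).
Proof.
move=> Kx Kgx xt cover.
pose f (i : space_D m) := iter (nat_of_ord (i : 'I_m.+1)) g x.
have Kf n : 0 < n -> K (iter n g x).
  by case: n => // n _; rewrite iterSr core_iter.
have inj (n k : nat) : n <= m -> k <= m -> iter n g x = iter k g x -> n = k.
  case: n k => [|n] [|k] // nm km.
  - by move=> /= e; have := Kf k.+1 isT; rewrite /= -e (negPf Kx).
  - by move=> /= e; have := Kf n.+1 isT; rewrite /= e (negPf Kx).
  - by rewrite !iterSr => /core_iter_inj ->.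
apply: (@isomorphic_of_bijection X (space_D m) f).
- by move=> i j /inj e; apply/val_inj/e; rewrite -ltnS ltn_ord.
- move=> y; have [Ky|/cover ->] := boolP (K y); last by exists (ord0 : 'I_m.+1).
  have [i im ->] := core_reach Kgx Ky.
  by exists (Ordinal (im : i.+1 < m.+1) : 'I_m.+1); rewrite /f iterSr.
- case=> i im [j jm]; rewrite /f /=.
  have -> : (Ordinal im <= Ordinal jm :> D_carrier m)%O = (i == j) || (i == 0) && (j == m) by [].
  case: i j im jm => [|i] [|j] im jm.
  + by rewrite lexx.
  + apply/idP/eqP => [/(core_below_twin Kgx (Kf j.+1 isT))/inj -> //|e].
    by have -> : iter j.+1 g x = twin x by rewrite e.
  + by rewrite (below_twin_not_above Kx Kgx xt (Kf i.+1 isT)).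
  + rewrite orbF; apply/idP/eqP => [|->]; last exact: lexx.
    by move=> /(core_antichain (Kf i.+1 isT) (Kf j.+1 isT)) /inj; apply.
- case=> i im; rewrite /f /= /D_g /=; case: ltnP => [lt|ge].
    by rewrite inordK.
  have -> : i = m by apply/eqP; rewrite eqn_leq ge -ltnS im.
  by rewrite inordK ?ltnS // -[RHS]/(g (twin x)) twin_g.
Qed.

Lemma tail_exists y : ~~ K y -> exists2 x, ~~ K x & K (g x).
Proof.
have [_ _ _ _ /(_ y) ex] := core; move=> Ky.
case: (ex_minnP ex) => -[|n] Kn nmin; first by rewrite /= Kn in Ky.
exists (iter n g y) => //; apply/negP => /nmin; by rewrite ltnn.
Qed.

Lemma classification_below x :
  (forall y, ~~ K y -> K (g y) -> (y <= twin y)%O || (twin y <= y)%O) ->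
  (forall y z, ~~ K y -> ~~ K z -> K (g y) -> K (g z) ->
     (y <= twin y)%O -> (twin z <= z)%O -> False) ->
  ~ partial_divisor Y4 X -> ~ partial_divisor Y6 X ->
  ~~ K x -> K (g x) -> (x <= twin x)%O -> os_isomorphic X (space_D m).
Proof.
move=> comparable no5 no4 no6 Kx Kgx xt; apply: (isomorphic_D Kx Kgx xt) => y Ky.
have only z : ~~ K z -> K (g z) -> z = x.
  move=> Kz Kgz; apply/eqP; apply: contrapT => /negP zx.
  case/orP: (comparable z Kz Kgz) => [zt|tz]; last exact: (no5 x z).
  by apply: no4; apply: (two_below_divisor Kx Kz).
(* A point that takes more than one step to reach the core passes through x. *)
have [_ _ _ _ /(_ y) ex] := core.
case: (ex_minnP ex) => -[|[|n]] Kn nmin; first by rewrite /= Kn in Ky.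
  exact: only.
have Kn1 : ~~ K (iter n.+1 g y) by apply/negP => /(nmin n.+1); rewrite ltnn.
case: no6; apply: (@long_tail_divisor x (iter n g y)) => //.
exact: (only (iter n.+1 g y)).
Qed.

End Tails.

Lemma classification (X : ockham_space) (x : X) :
  [/\ ~ os_divisor Y1 X, ~ os_divisor Y2 X, ~ os_divisor Y3 X, ~ os_divisor Y4 X
     & [/\ ~ os_divisor (os_op Y4) X, ~ os_divisor Y5 X, ~ os_divisor Y6 X
         & ~ os_divisor (os_op Y6) X]] ->
  exists m : nat, odd m /\ (os_isomorphic X (space_C m) \/
    os_isomorphic X (space_D m) \/ os_isomorphic X (os_op (space_D m))).
Proof.
have no Y : ~ os_divisor Y X -> ~ partial_divisor Y X by move=> h /divisor_of_partial.
move=> [/no no1 /no no2 /no no3 /no no4 [/no no4' /no no5 /no no6 /no no6']].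
have [c [m core]] := core_exists x no1 no3; exists m; split; first by case: core.
have [allK|] := pselect (forall y, fconnect os_g c y); first by left; apply: isomorphic_C core allK.
move=> /existsNP[y /negP /(tail_exists core)[{x y} x Kx Kgx]]; right.
have cmp y : ~~ fconnect os_g c y -> fconnect os_g c (os_g y) ->
    (y <= twin m y)%O || (twin m y <= y)%O by apply: (twin_comparable core).
have mixed y z : ~~ fconnect os_g c y -> ~~ fconnect os_g c z ->
    fconnect os_g c (os_g y) -> fconnect os_g c (os_g z) ->
    (y <= twin m y)%O -> (twin m z <= z)%O -> False.
  by move=> Ky Kz Kgy Kgz yt tz; apply: no5; apply: (below_and_above_divisor core Ky Kz).
case/orP: (cmp x Kx Kgx) => [xt|tx]; [left|right].
  exact: (classification_below core cmp mixed no4 no6 Kx Kgx xt).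
apply: isomorphic_op; apply: (classification_below (is_core_op core) _ _ _ _ Kx Kgx tx).
- by move=> y Ky Kgy; rewrite orbC; apply: cmp.
- by move=> y z Ky Kz Kgy Kgz yt tz; apply: (mixed z y).
- by move=> /partial_divisor_op.
- by move=> /partial_divisor_op.
Qed.

(** * Relations determined by their views *)

Section Coordinates.
Variables (d : Order.disp_t) (A : finOckhamType d) (X : finType).
Variables (g : X -> X) (ev : X -> A -> bool) (m : nat).

(** Compatibility expressed through coordinates.  It is invariant under negating
    all coordinates, so that it treats a space and its order dual alike. *)
Definition coordinate_closed k (r : {set k.-tuple A}) : Prop :=
  [/\ exists2 a, a \in r & forall i x, ev x (tnth a i) = false,
      exists2 a, a \in r & forall i x, ev x (tnth a i) = true,
      forall a b, a \in r -> b \in r -> exists2 c, c \in r &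
        forall i x, ev x (tnth c i) = ev x (tnth a i) || ev x (tnth b i),
      forall a b, a \in r -> b \in r -> exists2 c, c \in r &
        forall i x, ev x (tnth c i) = ev x (tnth a i) && ev x (tnth b i)
    & forall a, a \in r -> exists2 c, c \in r &
        forall i x, ev x (tnth c i) = ~~ ev (g x) (tnth a i)].

Local Notation tau := (iter m g).

Hypothesis ev_separates : forall a b, (forall x, ev x a = ev x b) -> a = b.
Hypothesis m_odd : odd m.
Hypothesis tau_idem : forall x, tau (tau x) = tau x.
Hypothesis ev_tau : forall x a, ev x a -> ev (tau x) a.
Hypothesis unfixed_unique : forall x y, tau x != x -> tau y != y -> x = y.
Hypothesis tau_transitive : forall x y, exists n, iter n g (tau x) = tau y.

Section OneRelation.
Variables (k : nat) (r : {set k.-tuple A}).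
Implicit Types (i j l : 'I_k) (x y z : X).

Definition entails i x j y : bool :=
  [forall a in r, ev x (tnth a i) ==> ev y (tnth a j)].

Lemma entailsP i x j y :
  reflect (forall a, a \in r -> ev x (tnth a i) -> ev y (tnth a j)) (entails i x j y).
Proof. by apply: (iffP forall_inP) => h a ra; [apply/implyP/h | apply/implyP/h]. Qed.

Lemma entails_refl i x : entails i x i x.
Proof. exact/entailsP. Qed.

Lemma entails_trans i x j y l z : entails i x j y -> entails j y l z -> entails i x l z.
Proof. by move=> /entailsP ij /entailsP jl; apply/entailsP => a ra /ij; auto. Qed.

Lemma entails_tau i x : entails i x i (tau x).
Proof. by apply/entailsP => a _; apply: ev_tau. Qed.

(** Up to tau, entailment is symmetric ([core_linked_sym]), so this is an
    equivalence between places. *)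
Definition core_linked i x j y : bool := entails i (tau x) j (tau y).

(** The coordinate moved by tau is forced to its largest possible value. *)
Definition tight j : bool := [forall x, entails j (tau x) j x].

Definition below i j : bool := [forall x, entails i x j x].

(** How j sits relative to i, except for the order among variables at the same
    position of the cycle. *)
Definition core_type i j : {ffun X * X -> bool} * bool * bool :=
  ([ffun p => core_linked i p.1 j p.2], tight i, tight j).

(** Tight variables are greatest at their position, hence comparable with
    everything there; connectedness only matters among the others. *)
Definition loose_step i j : bool :=
  [&& ~~ tight i, ~~ tight j & below i j || below j i].

Definition pair_type i j : ({ffun X * X -> bool} * bool * bool) * (bool * bool * bool * bool) :=
  (core_type i j, (below i j, below j i, connect loose_step i j, i == j)).

Definition view i := [set pair_type i j | j : 'I_k].

Hypothesis r_closed : coordinate_closed r.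

(** The meet of all members of r that are true at (i, x). *)
Lemma entailed_upset i x : exists2 a, a \in r & forall j y, ev y (tnth a j) = entails i x j y.
Proof.
have [_ [one one_r oneE] _ meet _] := r_closed.
have meets (s : seq (k.-tuple A)) : {subset s <= r} ->
    exists2 a, a \in r & forall j y, ev y (tnth a j) = all (fun c : k.-tuple A => ev y (tnth c j)) s.
  elim: s => [|c s IH] sr; first by exists one.
  have [|a ra aE] := IH; first by move=> b bs; apply: sr; rewrite inE bs orbT.
  have cr : c \in r by apply: sr; rewrite inE eqxx.
  by have [b br bE] := meet c a cr ra; exists b => // j y; rewrite bE aE.
have [|a ra aE] := meets [seq c <- enum r | ev x (tnth c i)].
  by move=> c; rewrite mem_filter mem_enum => /andP[].
exists a => // j y; rewrite aE all_filter; apply/allP/entailsP => h c.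
  by move=> rc; apply: (implyP (h c _)); rewrite mem_enum.
by rewrite mem_enum => /h ?; apply/implyP.
Qed.

(** Birkhoff duality for r: a tuple respecting all entailments of r is the join of
    the members of r given by [entailed_upset] at the places where it is true. *)
Lemma mem_of_entails (a : k.-tuple A) :
  (forall i x j y, entails i x j y -> ev x (tnth a i) -> ev y (tnth a j)) -> a \in r.
Proof.
move=> aP; have [[zero zero_r zeroE] _ join _ _] := r_closed.
have joins (s : seq ('I_k * X)) :
    exists2 b, b \in r & forall j y, ev y (tnth b j) = has (fun p => entails p.1 p.2 j y) s.
  elim: s => [|p s [b rb bE]]; first by exists zero.
  have [u ru uE] := entailed_upset p.1 p.2.
  by have [c rc cE] := join u b ru rb; exists c => // j y; rewrite cE uE bE.
have [b rb bE] := joins [seq p <- enum (predT : pred ('I_k * X)) | ev p.2 (tnth a p.1)].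
suff -> : a = b by [].
apply: eq_from_tnth => j; apply: ev_separates => y; rewrite bE.
apply/idP/hasP => [ay|[p]]; last by rewrite mem_filter => /andP[ap _] /aP; apply.
by exists (j, y); [rewrite mem_filter /= ay mem_enum | apply: entails_refl].
Qed.

Lemma entails_g i x j y : entails i x j y -> entails j (g y) i (g x).
Proof.
have [_ _ _ _ neg] := r_closed.
move=> /entailsP ij; apply/entailsP => a /neg[c rc cE]; apply: contraTT.
by rewrite -!cE; apply: ij.
Qed.

Lemma entails_iter_odd n i x j y : odd n -> entails i x j y ->
  entails j (iter n g y) i (iter n g x).
Proof.
move=> on ij; suff: if odd n then entails j (iter n g y) i (iter n g x)
                    else entails i (iter n g x) j (iter n g y) by rewrite on.
by elim: n {on} => //= n; case: (odd n) => /= /entails_g.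
Qed.

Lemma core_linked_of_entails i x j y : entails i x j y -> core_linked i x j y.
Proof.
move=> /(entails_iter_odd m_odd) /(entails_iter_odd m_odd).
by rewrite /core_linked !tau_idem.
Qed.

Lemma core_linked_refl i x : core_linked i x i x.
Proof. exact: entails_refl. Qed.

Lemma core_linked_sym i x j y : core_linked i x j y = core_linked j y i x.
Proof.
by apply/idP/idP => /(entails_iter_odd m_odd); rewrite !tau_idem.
Qed.

Lemma core_linked_trans i x j y l z :
  core_linked i x j y -> core_linked j y l z -> core_linked i x l z.
Proof. exact: entails_trans. Qed.

Lemma core_linked_iter n i x j y :
  core_linked i x j y -> core_linked i (iter n g x) j (iter n g y).
Proof.
elim: n => //= n IH /IH {IH}; rewrite core_linked_sym => /entails_g.
by rewrite /core_linked -!iterSr.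
Qed.

Lemma core_linked_tau i x j y : core_linked i (tau x) j y = core_linked i x j y.
Proof. by rewrite /core_linked tau_idem. Qed.

Lemma core_linked_reach i x j y z : core_linked i x j y -> exists x', core_linked i x' j z.
Proof.
have [n yz] := tau_transitive y z; move=> /(core_linked_iter n) h; exists (iter n g x).
rewrite /core_linked -yz -!iterD addnC in h *.
by move: h; rewrite iterD.
Qed.

Lemma below_core i j x : below i j -> core_linked i x j x.
Proof. by move=> /forallP/(_ x); apply: core_linked_of_entails. Qed.

Lemma tight_above i j : tight i -> below i j -> tight j.
Proof.
move=> /forallP ti ij; apply/forallP => x.
have ji : core_linked j x i x by rewrite core_linked_sym below_core.
by apply: entails_trans ji _; apply: entails_trans (ti x) _; apply: (forallP ij).
Qed.

(** All entailments come from the core, from tightness and from the order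
    [below].  The only coordinate that can behave differently from the core is
    the one moved by tau. *)
Lemma entailsE i x j y : entails i x j y =
  core_linked i x j y && [|| tau y == y, tight j | (x == y) && below i j].
Proof.
apply/idP/andP => [ij|[cij]]; last first.
  have step : entails i x j (tau y) by apply: entails_trans cij; apply: entails_tau.
  case/or3P => [/eqP <- //|tj|/andP[/eqP -> bij]]; last exact: (forallP bij).
  by apply: entails_trans step _; apply: (forallP tj).
have cij := core_linked_of_entails ij; split=> //.
have [//|yf] := eqVneq (tau y) y; rewrite /=.
have [xf|xf] := eqVneq (tau x) x; last first.
  have e := unfixed_unique xf yf; rewrite e in ij cij *; rewrite eqxx /=.
  apply/orP; right; apply/forallP => z.
  have [zf|/unfixed_unique/(_ yf) -> //] := eqVneq (tau z) z.
  have [n yz] := tau_transitive y z.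
  have := core_linked_iter n cij.
  rewrite -(core_linked_tau _ (iter n g y)) core_linked_sym -(core_linked_tau _ (iter n g y)).
  have -> : tau (iter n g y) = z by rewrite -iterD addnC iterD yz zf.
  by rewrite core_linked_sym /core_linked zf.
apply/orP; left; apply/forallP => z.
have [-> //|/unfixed_unique/(_ yf) ->] := eqVneq (tau z) z; first exact: entails_refl.
apply: entails_trans ij; rewrite -xf.
by move: cij; rewrite core_linked_sym.
Qed.

Definition same_class i j : bool := [exists x, exists y, core_linked i x j y].

Lemma same_classP i j : reflect (exists x y, core_linked i x j y) (same_class i j).
Proof.
apply: (iffP existsP) => -[x] => [/existsP[y]|[y]] h; exists x; first by exists y.
by apply/existsP; exists y.
Qed.

Lemma same_class_core i j y : same_class i j -> exists x, core_linked i x j y.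
Proof. by case/same_classP => x [z /core_linked_reach]; apply. Qed.

Lemma core_same_class i x j y : core_linked i x j y -> same_class i j.
Proof. by move=> h; apply/same_classP; exists x, y. Qed.

Lemma same_class_trans i j l : same_class i j -> same_class j l -> same_class i l.
Proof.
move=> ij /same_classP[x [y jl]]; have [z iz] := same_class_core x ij.
exact: core_same_class (core_linked_trans iz jl).
Qed.

Lemma same_class_sym i j : same_class i j = same_class j i.
Proof.
by apply/idP/idP => /same_classP[x [y]]; rewrite core_linked_sym => /core_same_class.
Qed.

Lemma below_refl i : below i i.
Proof. by apply/forallP => x; apply: entails_refl. Qed.

Lemma below_trans i j l : below i j -> below j l -> below i l.
Proof.
move=> /forallP ij /forallP jl; apply/forallP => x.
exact: entails_trans (ij x) (jl x).
Qed.

Lemma below_core_type c i j : below i j -> ~~ tight j -> core_type c i = core_type c j.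
Proof.
move=> ij tj; have ti : ~~ tight i by apply: contra tj => /tight_above; apply.
rewrite /core_type (negPf ti) (negPf tj); congr (_, _, _).
apply/ffunP => -[x y]; rewrite !ffunE /=; apply/idP/idP => h; apply: core_linked_trans h _.
  exact: below_core.
by rewrite core_linked_sym; apply: below_core.
Qed.

Lemma loose_connect_sym i j : connect loose_step i j = connect loose_step j i.
Proof.
by apply: sym_connect_sym => u v; rewrite /loose_step andbCA orbC.
Qed.

End OneRelation.

Section TwoRelations.
Variables (k l : nat) (r : {set k.-tuple A}) (s : {set l.-tuple A}).
Hypotheses (r_closed : coordinate_closed r) (s_closed : coordinate_closed s).
Hypothesis same_views : [set view r c | c : 'I_k] = [set view s i | i : 'I_l].
Implicit Types (c w : 'I_k) (i j : 'I_l) (F : 'I_k -> 'I_l).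

Lemma core_type_eq c w i j : core_type s i j = core_type r c w ->
  [/\ forall x y, core_linked s i x j y = core_linked r c x w y,
      tight s i = tight r c & tight s j = tight r w].
Proof.
rewrite /core_type => -[/ffunP core ti tj]; split=> // x y.
by have := core (x, y); rewrite !ffunE.
Qed.

Lemma pair_type_eq c w i j : pair_type s i j = pair_type r c w ->
  core_type s i j = core_type r c w /\
  [/\ below s i j = below r c w, below s j i = below r w c,
      connect (loose_step s) i j = connect (loose_step r) c w & (i == j) = (c == w)].
Proof. by move=> e; split; [exact: (congr1 fst e) | case: (congr1 snd e)]. Qed.

(** A map of variables that respects the entailments of r inside the class of c;
    different classes do not interact. *)
Definition local_map c F : Prop := forall w x w' y,
  same_class r c w -> entails r w x w' y -> entails s (F w) x (F w') y.

Lemma local_mapI c i F :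
  (forall w, same_class r c w -> core_type s i (F w) = core_type r c w) ->
  (forall w w', same_class r c w -> below r w w' -> ~~ tight r w' ->
     below s (F w) (F w')) ->
  local_map c F.
Proof.
move=> Fcore Fbelow w x w' y cw ww'.
have cw' : same_class r c w'.
  by apply: same_class_trans cw _ => //; apply: core_same_class (core_linked_of_entails _ ww').
have coreE z v t : same_class r c v -> core_linked s i z (F v) t = core_linked r c z v t.
  by move=> /Fcore/core_type_eq[].
have tightE v : same_class r c v -> tight s (F v) = tight r v.
  by move=> /Fcore/core_type_eq[].
have /andP[link cond] : core_linked r w x w' y &&
    [|| tau y == y, tight r w' | (x == y) && below r w w'] by rewrite -entailsE.
rewrite entailsE // tightE //; apply/andP; split.
  have [z cz] := same_class_core r_closed x cw.
  apply: (core_linked_trans (j := i) (y := z)); last first.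
    by rewrite coreE //; apply: core_linked_trans cz link.
  by rewrite core_linked_sym // coreE.
case: (tight r w') (Fbelow w w' cw) cond => [_ _|fb]; first by rewrite orbT.
by case/or3P => [-> //|//|/andP[-> /fb ->]] //; rewrite !orbT.
Qed.

Lemma view_partner c i w : view r c = view s i -> exists j, pair_type s i j = pair_type r c w.
Proof.
move=> ci; have : pair_type r c w \in view r c by apply: imset_f.
by rewrite ci => /imsetP[j _ ->]; exists j.
Qed.

(** Variables with the same core type have the same image, so that no order
    relation can be violated. *)
Definition default_map c i w : 'I_l :=
  odflt i [pick u | core_type s i u == core_type r c w].

Lemma default_mapP c i w : view r c = view s i ->
  core_type s i (default_map c i w) = core_type r c w.
Proof.
move=> /(view_partner w)[j /pair_type_eq[e _]]; rewrite /default_map.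
by case: pickP => [u /eqP //|/(_ j)]; rewrite e eqxx.
Qed.

Lemma default_map_local c i : view r c = view s i -> local_map c (default_map c i).
Proof.
move=> ci; apply: (local_mapI (i := i)) => [w _|w w' _ ww' tw']; first exact: default_mapP.
by rewrite /default_map (below_core_type r_closed c ww' tw'); apply: below_refl.
Qed.

(** On the other classes a default map is used, based at a canonical
    representative of the class. *)
Lemma local_map_extends c F : local_map c F -> exists2 psi : 'I_k -> 'I_l,
  forall w x w' y, entails r w x w' y -> entails s (psi w) x (psi w') y &
  forall w, same_class r c w -> psi w = F w.
Proof.
move=> Floc.
have exbase w : exists i, view r w = view s i.
  have : view r w \in [set view r c | c : 'I_k] by apply: imset_f.
  by rewrite same_views => /imsetP[i _ ->]; exists i.
have [base baseE] := choice exbase.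
pose root w := odflt w [pick u | same_class r w u].
have rootP w w' : same_class r w w' -> same_class r (root w) w.
  by rewrite /root; case: pickP => [u wu _|/(_ w') ->] //=; rewrite same_class_sym.
have rootE w w' : same_class r w w' -> root w = root w'.
  move=> ww'; have w'w : same_class r w' w by rewrite same_class_sym.
  have e : [pick u | same_class r w u] = [pick u | same_class r w' u].
    by apply: eq_pick => u; apply/idP/idP; apply: same_class_trans.
  by rewrite /root -e; case: pickP => // /(_ w'); rewrite ww'.
exists (fun w => if same_class r c w then F w else default_map (root w) (base (root w)) w);
  last by move=> w ->.
move=> w x w' y ww'.
have cls : same_class r w w' := core_same_class (core_linked_of_entails r_closed ww').
have <- : same_class r c w = same_class r c w'.
  apply/idP/idP => h; first exact: same_class_trans h cls.
  by apply: same_class_trans h _ => //; rewrite same_class_sym.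
case: ifP => [cw|_]; first exact: Floc ww'.
by rewrite -(rootE _ _ cls); apply: default_map_local (baseE _) _ _ _ _ (rootP _ _ cls) ww'.
Qed.

Variable a : l.-tuple A.
Hypothesis a_sat : forall phi, valid s r phi -> sat r a phi.

(** The extension of F is an atomic formula in r valid on s, so that a, composed
    with it, is a member of r. *)
Lemma local_map_transfer c F w x w' y : local_map c F -> same_class r c w ->
  entails r w x w' y -> ev x (tnth a (F w)) -> ev y (tnth a (F w')).
Proof.
move=> /local_map_extends[psi hom psiE] cw ww'.
have cw' : same_class r c w'.
  by apply: same_class_trans cw _ => //; apply: core_same_class (core_linked_of_entails _ ww').
have aR (b : l.-tuple A) v :
    tnth [tuple tnth b (tnth [tuple psi u | u < k] j) | j < k] v = tnth b (psi v).
  by rewrite !tnth_mktuple.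
have : sat r a (AtomRel [tuple psi w | w < k]).
  apply: a_sat; apply/forall_inP => b sb /=; apply: (mem_of_entails r_closed).
  by move=> v z v' t /hom/entailsP/(_ b sb); rewrite !aR.
by move=> /= /(entailsP _ _ _ _ _ ww'); rewrite !aR !psiE.
Qed.

Lemma pair_type_entails c w i j x y : pair_type s i j = pair_type r c w ->
  entails s i x j y = entails r c x w y /\ entails s j x i y = entails r w x c y.
Proof.
move=> /pair_type_eq[/core_type_eq[coreE ti tj] [b1 b2 _ _]].
have coreE' z t : core_linked s j z i t = core_linked r w z c t.
  by rewrite core_linked_sym // coreE core_linked_sym.
by rewrite !entailsE // coreE coreE' ti tj b1 b2.
Qed.


(** The purpose is to hit both i and j: taking Q to be everything, an up-set, or a
    connected component handles the possible positions of j relative to i. *)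
Definition steered_map (Q : pred 'I_k) c i j w : 'I_l :=
  if (core_type r c w == core_type s i j) && Q w then j else
  if core_type r c w == core_type s i i then i else default_map c i w.

Lemma steered_map_local (Q : pred 'I_k) c i j : view r c = view s i ->
  (forall w w', below r w w' -> ~~ tight r w' -> core_type r c w' = core_type s i j ->
     (Q w -> Q w') /\
     (~~ Q w -> Q w' -> below s i j /\ core_type s i j = core_type s i i)) ->
  local_map c (steered_map Q c i j).
Proof.
move=> ci QP; apply: (local_mapI (i := i)) => [w _|w w' _ ww' tw'].
  rewrite /steered_map; case: ifP => [/andP[/eqP -> //]|_].
  by case: ifP => [/eqP -> //|_]; apply: default_mapP.
have e := below_core_type r_closed c ww' tw'.
rewrite /steered_map /default_map e.
have [ej|_] := eqVneq (core_type r c w') (core_type s i j); last exact: below_refl.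
have [up new] := QP w w' ww' tw' ej; rewrite /=.
move: up new; case: (Q w) => [/(_ isT) -> _|_ new]; first exact: below_refl.
move: new; case: (Q w') => [/(_ isT isT)[bij eij]|_]; last exact: below_refl.
by rewrite ej eij eqxx.
Qed.

Lemma view_source i : exists c, view r c = view s i.
Proof.
have : view s i \in [set view s i | i : 'I_l] by apply: imset_f.
by rewrite -same_views => /imsetP[c _ ->]; exists c.
Qed.

Lemma pair_source c i j : view r c = view s i -> exists w, pair_type s i j = pair_type r c w.
Proof.
move=> ci; have : pair_type s i j \in view s i by apply: imset_f.
by rewrite -ci => /imsetP[w _ ->]; exists w.
Qed.

Lemma pair_source_refl c i : view r c = view s i -> pair_type s i i = pair_type r c c.
Proof.
move=> ci; have [w e] := pair_source i ci.
by have [_ [_ _ _ /esym]] := pair_type_eq e; rewrite eqxx => /eqP cw; rewrite e -cw.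
Qed.

Lemma steered_transfer (Q : pred 'I_k) c i j w : view r c = view s i ->
  pair_type s i j = pair_type r c w ->
  local_map c (steered_map Q c i j) -> Q w ->
  core_type s i i != core_type s i j \/ ~~ Q c ->
  forall x y,
    (entails s i x j y -> ev x (tnth a i) -> ev y (tnth a j)) /\
    (entails s j x i y -> ev x (tnth a j) -> ev y (tnth a i)).
Proof.
move=> ci ijw loc Qw notc x y.
have [cii _] := pair_type_eq (pair_source_refl ci).
have [cij _] := pair_type_eq ijw.
have Fc : steered_map Q c i j c = i.
  rewrite /steered_map -cii eqxx; case: notc => [/negPf ->|/negPf ->] //.
  by rewrite andbF.
have Fw : steered_map Q c i j w = j by rewrite /steered_map cij eqxx Qw.
have [e1 e2] := pair_type_entails x y ijw; rewrite e1 e2; split=> h.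
  have cc := core_same_class (core_linked_of_entails r_closed h).
  have cc' : same_class r c c by apply: (same_class_trans r_closed cc); rewrite (same_class_sym r_closed).
  by have := local_map_transfer loc cc' h; rewrite Fc Fw.
have cw : same_class r c w.
  by rewrite (same_class_sym r_closed); exact: core_same_class (core_linked_of_entails r_closed h).
by have := local_map_transfer loc cw h; rewrite Fc Fw.
Qed.

Lemma diagonal_transfer i x y : entails s i x i y -> ev x (tnth a i) -> ev y (tnth a i).
Proof.
have [c ci] := view_source i; have cc := pair_source_refl ci.
have loc : local_map c (steered_map pred0 c i i) by apply: steered_map_local.
have Fc : steered_map pred0 c i i c = i.
  by rewrite /steered_map andbF; have [-> _] := pair_type_eq cc; rewrite eqxx.
have [-> _] := pair_type_entails x y cc; move=> h.
have cl := core_same_class (core_linked_of_entails r_closed h).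
by have := local_map_transfer loc cl h; rewrite Fc.
Qed.

Lemma equal_transfer i j : below s i j -> below s j i -> tnth a i = tnth a j.
Proof.
move=> /forallP ij /forallP ji.
have /= : sat r a (AtomEq k i j).
  apply: a_sat; apply/forall_inP => b sb /=; apply/eqP; apply: ev_separates => x.
  by apply/idP/idP; [apply: (entailsP _ _ _ _ _ (ij x)) | apply: (entailsP _ _ _ _ _ (ji x))].
by move/eqP.
Qed.

(** Variables with different core types are never in order with each other unless
    the larger one is tight, so i and j can be hit independently. *)
Lemma far_transfer i j x y : core_type s i j != core_type s i i ->
  entails s i x j y -> ev x (tnth a i) -> ev y (tnth a j).
Proof.
move=> far; have [c ci] := view_source i; have [w ijw] := pair_source j ci.
have loc : local_map c (steered_map predT c i j) by apply: steered_map_local.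
have notc : core_type s i i != core_type s i j \/ ~~ predT c by left; rewrite eq_sym.
by have [+ _] := steered_transfer ci ijw loc isT notc x y.
Qed.

(** Collapse the position of i onto the two-element chain of i and j. *)
Lemma below_transfer i j : below s i j -> ~~ below s j i -> ~~ tight s j ->
  forall x y,
    (entails s i x j y -> ev x (tnth a i) -> ev y (tnth a j)) /\
    (entails s j x i y -> ev x (tnth a j) -> ev y (tnth a i)).
Proof.
move=> ij ji tj; have [c ci] := view_source i; have [w ijw] := pair_source j ci.
have [_ [_ wc _ _]] := pair_type_eq ijw.
apply: (steered_transfer ci ijw _ (below_refl r w)); last by right; rewrite -wc.
apply: steered_map_local => // u u' uu' _ _; split; first by move=> wu; apply: below_trans uu'.
by move=> _ _; split=> //; rewrite -(below_core_type s_closed i ij tj).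
Qed.

(** Collapse the component of j to j and the other components to i. *)
Lemma unconnected_transfer i j : ~~ connect (loose_step s) i j ->
  forall x y, entails s i x j y -> ev x (tnth a i) -> ev y (tnth a j).
Proof.
move=> nij x y; have [c ci] := view_source i; have [w ijw] := pair_source j ci.
have [_ [_ _ cw _]] := pair_type_eq ijw.
suff loc : local_map c (steered_map (connect (loose_step r) w) c i j).
  have notc : core_type s i i != core_type s i j \/ ~~ connect (loose_step r) w c.
    by right; rewrite loose_connect_sym -cw.
  by have [+ _] := steered_transfer ci ijw loc (connect0 _ w) notc x y.
apply: steered_map_local => // u u' uu' tu' _.
have tu : ~~ tight r u by apply: contra tu' => /(tight_above r_closed); apply.
split=> [wu|nu wu']; first by apply: connect_trans wu (connect1 _); rewrite /loose_step tu tu' uu'.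
case/negP: nu; apply: connect_trans wu' (connect1 _).
by rewrite /loose_step tu tu' uu' orbT.
Qed.

Lemma loose_step_transfer i j x y : loose_step s i j ->
  entails s i x j y -> ev x (tnth a i) -> ev y (tnth a j).
Proof.
case/and3P => ti tj.
case ij: (below s i j); case ji: (below s j i) => //= _ h.
- rewrite (equal_transfer ij ji); apply: diagonal_transfer.
  by apply: entails_trans h; apply: (forallP ji).
- by have [+ _] := below_transfer ij (negbT ji) tj x y; apply.
- by have [_ +] := below_transfer ji (negbT ij) ti x y; apply.
Qed.

Lemma connected_transfer i j x : connect (loose_step s) i j ->
  core_linked s i x j x /\ (ev (tau x) (tnth a i) -> ev (tau x) (tnth a j)).
Proof.
case/connectP => p; elim: p i => [|u p IH] i /=; first by move=> _ ->; split=> //; apply: core_linked_refl.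
case/andP => iu up je; have [uj tuj] := IH u up je.
have step : core_linked s i x u x.
  case/and3P: (iu) => _ _ /orP[]; first exact: below_core.
  by rewrite core_linked_sym //; apply: below_core.
split; first exact: core_linked_trans step uj.
by move=> /(loose_step_transfer iu step) /tuj.
Qed.

(** Variables i and j at the same position that are incomparable but connected
    need no map of their own: equality of their core coordinates is transferred
    along a path of comparable variables. *)
Lemma entails_transfer i x j y : entails s i x j y -> ev x (tnth a i) -> ev y (tnth a j).
Proof.
move=> h; have [ecore|far] := eqVneq (core_type s i j) (core_type s i i); last exact: far_transfer.
have [conn|] := boolP (connect (loose_step s) i j); last by move=> /unconnected_transfer; apply.
have tij : tight s j = tight s i := congr1 snd ecore.
have [tj|tj] := boolP (tight s j).
  have cij z : core_linked s i z j z.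
    have := ecore; rewrite /core_type => -[/ffunP/(_ (z, z))]; rewrite !ffunE /= => -> *.
    exact: core_linked_refl.
  have bij : below s i j by apply/forallP => z; rewrite entailsE // cij tj orbT.
  have bji : below s j i.
    by apply/forallP => z; rewrite entailsE // core_linked_sym // cij -tij tj orbT.
  rewrite -(equal_transfer bij bji); apply: diagonal_transfer.
  by apply: entails_trans h _; apply: (forallP bji).
have [comp|] := boolP (below s i j || below s j i).
  by apply: loose_step_transfer h; rewrite /loose_step -tij tj comp.
rewrite negb_or => /andP[/negPf bij _].
move: h; rewrite entailsE // bij (negPf tj) andbF !orbF => /andP[cij /eqP yf] ax.
have [cx txj] := connected_transfer x conn.
have := txj (ev_tau ax); apply: diagonal_transfer.
rewrite entailsE // yf eqxx andbT core_linked_tau // core_linked_sym //.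
by apply: core_linked_trans cx; rewrite core_linked_sym.
Qed.

End TwoRelations.

Lemma definable_of_same_views k l (r : {set k.-tuple A}) (s : {set l.-tuple A}) :
  coordinate_closed r -> coordinate_closed s ->
  [set view r c | c : 'I_k] = [set view s i | i : 'I_l] ->
  conjunct_atomic_definable s r.
Proof.
move=> rc sc e; apply/definableP => a aP; apply: (mem_of_entails sc).
exact: (entails_transfer rc sc e aP).
Qed.

Lemma finitely_many_of_coordinates :
  (forall k (r : {set k.-tuple A}), compatible r -> coordinate_closed r) ->
  admits_finitely_many_relations A.
Proof.
move=> closed.
apply: (@finitely_many_of_invariant _ A _ (fun r => [set view (tuples r) i | i : 'I_(arity r)])).
by move=> r s rc sc e; apply: definable_of_same_views; rewrite ?e //; apply: closed.
Qed.

End Coordinates.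

(** * Duals with one odd cycle and at most one further point *)

Section SmallDuals.
Variables (d : Order.disp_t) (A : finOckhamType d).

(** The tail consists of at most one point. *)
Definition one_cycle_with_tail (Z : ockham_space) (m : nat) : Prop :=
  [/\ forall x : Z, iter m os_g (iter m os_g x) = iter m os_g x,
      forall x y : Z, iter m os_g x != x -> iter m os_g y != y -> x = y
    & forall x y : Z, exists n, iter n os_g (iter m os_g x) = iter m os_g y].

(** When tau moves its point down, all coordinates are negated, which exchanges
    joins and meets. *)
Lemma finitely_many_of_isomorphic (Z : ockham_space) (m : nat) :
  odd m -> one_cycle_with_tail Z m ->
  (forall x : Z, (x <= iter m os_g x)%O) \/ (forall x : Z, (iter m os_g x <= x)%O) ->
  os_isomorphic (dual_space A) Z -> admits_finitely_many_relations A.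
Proof.
move=> om [idem uniq trans] ext [h [k [[hle hg] [kle kg] hk kh]]].
pose neg := ~~ `[< forall x : Z, (x <= iter m os_g x)%O >].
pose ev (x : Z) (a : A) := neg (+) sval (k x : dual_carrier A) a.
apply: (@finitely_many_of_coordinates _ A Z (@os_g Z) ev m) => //.
- move=> a b ab; apply: dual_separates => x; have := ab (h x).
  by rewrite /ev hk; case: (neg) => /=; do 2!case: (sval x _).
- move=> x a; rewrite /ev /neg; case: asboolP => /= [up|noup].
    by move: a; apply/dual_leP; apply: kle.
  have down : (iter m os_g x <= x)%O by case: ext.
  by apply: contraNN; move: a; apply/dual_leP; apply: kle.
- move=> n r [_ [bot top join meet onegr]]; rewrite /coordinate_closed /ev.
  have negE x a : sval (k x : dual_carrier A) (oneg a) = ~~ sval (k (os_g x) : dual_carrier A) a.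
    by rewrite kg dual_oneg.
  case: (neg) => /=; split.
  + by exists [tuple \top%O | _ < n] => // i x; rewrite tnth_mktuple dual_top.
  + by exists [tuple \bot%O | _ < n] => // i x; rewrite tnth_mktuple dual_bot.
  + move=> a b ra rb; exists [tuple (tnth a i `&` tnth b i)%O | i < n] => [|i x]; first exact: meet.
    by rewrite tnth_mktuple dual_meet negb_and.
  + move=> a b ra rb; exists [tuple (tnth a i `|` tnth b i)%O | i < n] => [|i x]; first exact: join.
    by rewrite tnth_mktuple dual_join negb_or.
  + move=> a ra; exists [tuple oneg (tnth a i) | i < n] => [|i x]; first exact: onegr.
    by rewrite tnth_mktuple negE.
  + by exists [tuple \bot%O | _ < n] => // i x; rewrite tnth_mktuple dual_bot.
  + by exists [tuple \top%O | _ < n] => // i x; rewrite tnth_mktuple dual_top.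
  + move=> a b ra rb; exists [tuple (tnth a i `|` tnth b i)%O | i < n] => [|i x]; first exact: join.
    by rewrite tnth_mktuple dual_join.
  + move=> a b ra rb; exists [tuple (tnth a i `&` tnth b i)%O | i < n] => [|i x]; first exact: meet.
    by rewrite tnth_mktuple dual_meet.
  + move=> a ra; exists [tuple oneg (tnth a i) | i < n] => [|i x]; first exact: onegr.
    by rewrite tnth_mktuple negE.
Qed.

Lemma iter_ordS m n (i : 'I_m) : iter n (@ordS m) i = (i + n) %% m :> nat.
Proof.
elim: n => [|n IH] /=; first by rewrite addn0 modn_small.
by rewrite IH addnS -[in LHS]addn1 modnDml addn1.
Qed.

Lemma space_C_tail m : odd m -> one_cycle_with_tail (space_C m) m /\
  forall x : space_C m, iter m os_g x = x.
Proof.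
move=> om; have fixed (x : space_C m) : iter m os_g x = x.
  by apply/val_inj/(etrans (iter_ordS m (x : 'I_m))); rewrite modnDr modn_small ?ltn_ord.
split=> //; split=> [x|x y|x y]; rewrite ?fixed ?eqxx //.
exists ((y : 'I_m) + (m - (x : 'I_m)))%N; apply/val_inj/(etrans (iter_ordS _ (x : 'I_m))).
by rewrite addnCA subnKC 1?ltnW // modnDr modn_small.
Qed.

(** This formula also covers the value m, which g sends to 1. *)
Lemma D_gE m (x : 'I_m.+1) : 0 < m -> D_g x = (x %% m).+1 :> nat.
Proof.
move=> m0; rewrite /D_g; case: ltnP => [lt|ge].
  by rewrite inordK ?ltnS // modn_small.
have -> : x = m :> nat by apply/eqP; rewrite eqn_leq ge -ltnS ltn_ord.
by rewrite inordK ?ltnS // modnn.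
Qed.

Lemma iter_D_g m n (x : 'I_m.+1) : 0 < m -> iter n.+1 (@D_g m) x = ((x + n) %% m).+1 :> nat.
Proof.
move=> m0; elim: n => [|n IH]; first by rewrite /= D_gE // addn0.
by rewrite iterS D_gE // IH addnS; congr _.+1; rewrite -[in LHS]addn1 modnDml addn1.
Qed.

Lemma iter_m_D_g m (x : 'I_m.+1) : 0 < m ->
  iter m (@D_g m) x = (if x == 0 :> nat then m else x) :> nat.
Proof.
case: m x => // m x _; rewrite iter_D_g //.
case: eqP => [->|/eqP]; first by rewrite add0n modn_small.
rewrite -lt0n => x0; rewrite -(prednK x0) addSnnS modnDr modn_small //.
by rewrite prednK // -ltnS ltn_ord.
Qed.

Lemma space_D_tail m : odd m -> one_cycle_with_tail (space_D m) m /\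
  forall x : space_D m, (x <= iter m os_g x)%O.
Proof.
move=> om; have m0 := odd_gt0 om.
have tauE (x : 'I_m.+1) := iter_m_D_g x m0.
split; first split.
- move=> x; apply/val_inj; rewrite /= !tauE; case: (nat_of_ord x) => [|z] //=.
  by rewrite gtn_eqF.
- have zero (x : 'I_m.+1) : iter m (@D_g m) x != x -> x = 0 :> nat.
    by apply: contraNeq => x0; apply/eqP/val_inj; rewrite /= tauE (negPf x0).
  by move=> x y /zero x0 /zero y0; apply/val_inj; rewrite /= x0 y0.
- move=> x y; exists (((iter m (@D_g m) y : 'I_m.+1).-1 + (m - (iter m (@D_g m) x : 'I_m.+1))).+1)%N.
  have pos (z : 'I_m.+1) : 0 < (iter m (@D_g m) z : 'I_m.+1).
    by rewrite tauE; case: ifP => // /negbT; rewrite -lt0n.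
  apply/val_inj; rewrite [val _]iter_D_g // addnCA subnKC; last by rewrite -ltnS ltn_ord.
  by rewrite modnDr modn_small prednK // -ltnS ?prednK // ltn_ord.
- move=> x; have [x0|x0] := eqVneq (nat_of_ord (x : 'I_m.+1)) 0.
    apply/orP; right; apply/andP; split; apply/eqP/val_inj => //=.
    by rewrite tauE x0.
  apply/orP; left; apply/eqP/val_inj; by rewrite /= tauE (negPf x0).
Qed.

End SmallDuals.

Theorem theorem1p1 (d : Order.disp_t) (A : finOckhamType d)
    (A_nontrivial : 1 < #|A|) :
  (admits_finitely_many_relations A <->
   exists m : nat,
     odd m /\ (os_isomorphic (dual_space A) (space_C m) \/
               os_isomorphic (dual_space A) (space_D m) \/
               os_isomorphic (dual_space A) (os_op (space_D m)))) /\
  (admits_finitely_many_relations A <->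
   [/\ ~ os_divisor Y1 (dual_space A),
       ~ os_divisor Y2 (dual_space A),
       ~ os_divisor Y3 (dual_space A),
       ~ os_divisor Y4 (dual_space A)
     & [/\ ~ os_divisor (os_op Y4) (dual_space A),
           ~ os_divisor Y5 (dual_space A),
           ~ os_divisor Y6 (dual_space A)
         & ~ os_divisor (os_op Y6) (dual_space A)]]).
Proof.
have finite_no_divisor : admits_finitely_many_relations A ->
   [/\ ~ os_divisor Y1 (dual_space A), ~ os_divisor Y2 (dual_space A),
       ~ os_divisor Y3 (dual_space A), ~ os_divisor Y4 (dual_space A)
     & [/\ ~ os_divisor (os_op Y4) (dual_space A), ~ os_divisor Y5 (dual_space A),
           ~ os_divisor Y6 (dual_space A) & ~ os_divisor (os_op Y6) (dual_space A)]].
  move=> fin; split=> [/infinitely_many_of_Y1|/infinitely_many_of_Y2|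
      /infinitely_many_of_Y3|/infinitely_many_of_Y4|] //.
  by split=> [/infinitely_many_of_Y4_op|/infinitely_many_of_Y5|
      /infinitely_many_of_Y6|/infinitely_many_of_Y6_op].
have [x _] := dual_inhabited A_nontrivial.
have classify := @classification (dual_space A) x.
have iso_finite : (exists m : nat,
     odd m /\ (os_isomorphic (dual_space A) (space_C m) \/
               os_isomorphic (dual_space A) (space_D m) \/
               os_isomorphic (dual_space A) (os_op (space_D m)))) ->
    admits_finitely_many_relations A.
  case=> m [om [iso|[iso|iso]]].
  - have [tailC fixed] := space_C_tail om.
    by apply: (finitely_many_of_isomorphic om tailC _ iso); left=> y; rewrite fixed.
  - have [tailD up] := space_D_tail om.
    by apply: (finitely_many_of_isomorphic om tailD _ iso); left.
  - have [tailD up] := space_D_tail om.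
    by apply: (finitely_many_of_isomorphic om (Z := os_op (space_D m)) tailD _ iso); right.
by split; split; auto.
Qed.
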